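(* Among the simply connected two-step nilpotent Lie groups of dimension five equipped with left invariant Riemannian metrics, the only ones which admit a left invariant Randers metric of Berwald type (with the given Riemannian metric as underlying metric) are those with three-dimensional center. In that case, let $N$ be such a group with left invariant Riemannian metric $g$, whose Lie algebra $\mathfrak{n}$ has three-dimensional center, and let $\{e_1,e_2,e_3,e_4,e_5\}$ be an orthonormal basis of $\mathfrak{n}$ such that $[e_1,e_2]=\lambda e_3$ with $\lambda>0$, the other commutators are zero, and $\{e_3,e_4,e_5\}$ is a basis of the center. Then $N$ admits a family of left invariant Randers metrics of Berwald type. Moreover, if $Q\in\mathfrak{n}$ is a left invariant vector field on $N$ which is parallel with respect to the Levi-Civita connection of $g$, then $Q=q_1e_4+q_2e_5$ for some $q_1,q_2\in\mathbb{R}$; and since the vector field defining a Randers metric must have length less than $1$, for such a (nonzero) $Q$ defining a Randers metric one has $0<\sqrt{q_1^2+q_2^2}<1$.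
   Context: For a Riemannian metric $g$ and a nonzero vector field $X$ on a manifold $M$ with $\sqrt{g(X,X)}<1$, the Randers metric defined by $g$ and $X$ is the Finsler metric $F(x,Y)=\sqrt{g(x)(Y,Y)}+g(x)(X(x),Y)$ for $x\in M$, $Y\in T_xM$; $g$ is called its underlying Riemannian metric. Such an $F$ is of Berwald type if and only if $X$ is parallel with respect to the Levi-Civita connection of $g$; this may be taken as the definition. A Finsler metric $F$ on a Lie group $G$ with unit element $e$ is left invariant if $F(a,Y)=F(e,T_a l_{a^{-1}}Y)$ for all $a\in G$, $Y\in T_aG$, where $l_{a^{-1}}$ is left translation by $a^{-1}$. The left invariant Randers metrics on a Lie group with underlying left invariant Riemannian metric $g$ correspond to the left invariant vector fields of length less than $1$. A Lie group is two-step nilpotent if its Lie algebra $\mathfrak{n}$ is non-abelian and $[\mathfrak{n},[\mathfrak{n},\mathfrak{n}]]=0$. In dimension five the center of such a Lie algebra has dimension one, two or three, and by a known classification of Homolya and Kowalski an orthonormal basis of the stated form exists when the center is three-dimensional. Elements of $\mathfrak{n}$ are identified with left invariant vector fields on $N$. *)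

(* Defs.v *)
From HB Require Import structures.
From mathcomp Require Import all_boot all_order all_algebra.
From mathcomp Require Import all_classical all_reals all_analysis.
Set Implicit Arguments.
Unset Strict Implicit.
Unset Printing Implicit Defensive.
Import Order.TTheory GRing.Theory Num.Theory numFieldNormedType.Exports.
Local Open Scope classical_set_scope.
Local Open Scope ring_scope.

Section LinearAlgebra.
Context {R : realType} {V : lmodType R}.

Definition is_basis (S : set V) k (b : k.-tuple V) : Prop :=
  (forall c : 'I_k -> R, \sum_i c i *: tnth b i = 0 -> forall i, c i = 0) /\
  S = [set v | exists c : 'I_k -> R, v = \sum_i c i *: tnth b i].

Definition has_dim (S : set V) (k : nat) : Prop :=
  exists b : k.-tuple V, is_basis S b.

End LinearAlgebra.

Section Smoothness.
Context {R : realType} {V W : normedModType R}.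

(* Meant for U open and V finite-dimensional, where the continuity of          *)
(* x |-> 'd f x is that of x |-> 'd f x v for every v.                         *)
Fixpoint Ck_on (k : nat) (U : set V) (f : V -> W) : Prop :=
  if k is k'.+1 then
    (forall x, U x -> differentiable f x) /\
    forall v : V, Ck_on k' U (fun x => 'd f x v)
  else forall x, U x -> {for x, continuous f}.

Definition smooth_on (U : set V) (f : V -> W) : Prop :=
  forall k, Ck_on k U f.

End Smoothness.

(* An n-dimensional smooth manifold. The smooth structure is given by an atlas *)
(* containing one chosen chart around each point p, namely                     *)
(* coord p : chart_dom p -> R^n with inverse param p (both functions are total *)
(* and meaningless outside chart_dom p and its image). Every smooth atlas has  *)
(* a subatlas of this kind (repetitions allowed), with the same smooth         *)
(* structure. The tangent space at p is 'rV[R]_n: a tangent vector at p is     *)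
(* given by its components in the chart chosen at p.                           *)
HB.mixin Record Topological_isManifold (R : realType) (n : nat) M
    of Topological M := {
  chart_dom : M -> set M ;
  coord : M -> M -> 'rV[R]_n ;
  param : M -> 'rV[R]_n -> M ;
  manifold_hausdorff : hausdorff_space M ;
  manifold_second_countable : @second_countable M ;
  chart_dom_open : forall p, open (chart_dom p) ;
  chart_dom_center : forall p, chart_dom p p ;
  chart_image_open : forall p, open (coord p @` chart_dom p) ;
  coordK : forall p q, chart_dom p q -> param p (coord p q) = q ;
  coord_continuous : forall p q, chart_dom p q -> {for q, continuous (coord p)} ;
  param_continuous : forall p x, (coord p @` chart_dom p) x ->
    {for x, continuous (param p)} ;
  chart_compatible : forall p q,
    smooth_on (coord p @` (chart_dom p `&` chart_dom q)) (coord q \o param p)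
}.

#[short(type="manifoldType")]
HB.structure Definition Manifold (R : realType) (n : nat) :=
  {M of Topological_isManifold R n M & Topological M}.

Section Manifolds.
Context {R : realType} {n : nat} {M : manifoldType R n}.
Implicit Types (p q : M) (f : M -> R) (X Y Z : M -> 'rV[R]_n).

Definition chart_image p : set 'rV[R]_n := coord p @` chart_dom p.

Definition smooth_fun f : Prop :=
  forall p, smooth_on (chart_image p) (f \o param p).

(* The differential at p of a map F : M -> M, from T_p M to T_(F p) M. *)
Definition tangent_map (F : M -> M) p : 'rV[R]_n -> 'rV[R]_n :=
  'd (coord (F p) \o F \o param p) (coord p p).

(* Change of components, from the chart chosen at q to the chart at p. *)
Definition to_chart p q : 'rV[R]_n -> 'rV[R]_n :=
  'd (coord p \o param q) (coord q q).

(* Change of components at q, from the chart at p to the chart chosen at q. *)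
Definition from_chart p q : 'rV[R]_n -> 'rV[R]_n :=
  'd (coord q \o param p) (coord p q).

(* The local expression of X in the chart at p, as a function on R^n. *)
Definition vf_local X p : 'rV[R]_n -> 'rV[R]_n :=
  fun x => to_chart p (param p x) (X (param p x)).

Definition smooth_vf X : Prop :=
  forall p, smooth_on (chart_image p) (vf_local X p).

Definition vf_deriv X f : M -> R :=
  fun p => 'd (f \o param p) (coord p p) (X p).

(* The sign is the one for which [X, Y] f = X (Y f) - Y (X f). *)
Definition lie_bracket X Y : M -> 'rV[R]_n :=
  fun p => 'd (vf_local Y p) (coord p p) (X p)
         - 'd (vf_local X p) (coord p p) (Y p).

(* A field of bilinear forms on the tangent spaces. *)
Implicit Types g : M -> 'rV[R]_n -> 'rV[R]_n -> R.

Definition riemannian g : Prop :=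
  [/\ forall p (a : R) u v w, g p (a *: u + v) w = a * g p u w + g p v w,
      forall p u v, g p u v = g p v u,
      forall p u, u != 0 -> 0 < g p u u &
      forall p u v, smooth_on (chart_image p) (fun x =>
        g (param p x) (from_chart p (param p x) u)
                      (from_chart p (param p x) v))].

Definition vf_inner g X Y : M -> R := fun p => g p (X p) (Y p).

Definition vf_scale f X : M -> 'rV[R]_n := fun p => f p *: X p.

(* Connections act on smooth vector fields; their values on other functions   *)
(* M -> 'rV[R]_n are irrelevant.                                               *)
Implicit Types D : (M -> 'rV[R]_n) -> (M -> 'rV[R]_n) -> M -> 'rV[R]_n.

Definition affine_connection D : Prop :=
  [/\ forall X Y, smooth_vf X -> smooth_vf Y -> smooth_vf (D X Y),
      forall X X' Y, smooth_vf X -> smooth_vf X' -> smooth_vf Y ->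
        D (X + X') Y = D X Y + D X' Y,
      forall f X Y, smooth_fun f -> smooth_vf X -> smooth_vf Y ->
        D (vf_scale f X) Y = vf_scale f (D X Y),
      forall X Y Y', smooth_vf X -> smooth_vf Y -> smooth_vf Y' ->
        D X (Y + Y') = D X Y + D X Y' &
      forall f X Y, smooth_fun f -> smooth_vf X -> smooth_vf Y ->
        D X (vf_scale f Y) = vf_scale (vf_deriv X f) Y + vf_scale f (D X Y)].

Definition levi_civita g D : Prop :=
  [/\ affine_connection D,
      forall X Y, smooth_vf X -> smooth_vf Y ->
        D X Y - D Y X = lie_bracket X Y &
      forall X Y Z, smooth_vf X -> smooth_vf Y -> smooth_vf Z ->
        vf_deriv X (vf_inner g Y Z) =
        vf_inner g (D X Y) Z + vf_inner g Y (D X Z)].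

Definition parallel g X : Prop :=
  smooth_vf X /\
  exists2 D, levi_civita g D & forall Y, smooth_vf Y -> D Y X = 0.

(* (g, X) defines a Randers metric. *)
Definition randers_data g X : Prop :=
  [/\ smooth_vf X, X <> 0 & forall p, Num.sqrt (g p (X p) (X p)) < 1].

Definition randers g X : M -> 'rV[R]_n -> R :=
  fun p u => Num.sqrt (g p u u) + g p (X p) u.

Definition path_connected : Prop :=
  forall p q, exists c : R -> M,
    [/\ {within `[0, 1], continuous c}, c 0 = p & c 1 = q].

Definition null_homotopic (c : R -> M) : Prop :=
  exists H : R * R -> M,
    [/\ {within `[0, 1] `*` `[0, 1], continuous H},
        {in `[0, 1], forall t, H (0, t) = c t},
        {in `[0, 1], forall t, H (1, t) = c 0},
        {in `[0, 1], forall s, H (s, 0) = c 0} &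
        {in `[0, 1], forall s, H (s, 1) = c 0}].

Definition simply_connected : Prop :=
  path_connected /\
  forall c : R -> M, {within `[0, 1], continuous c} -> c 0 = c 1 ->
    null_homotopic c.

End Manifolds.

Arguments simply_connected {R n} M.

HB.mixin Record Manifold_isLieGroup (R : realType) (n : nat) G
    of Manifold R n G & Group G := {
  mulg_continuous : continuous (fun z : G * G => (z.1 * z.2)%g) ;
  mulg_smooth : forall p q r : G,
    smooth_on
      [set z : 'rV[R]_n * 'rV[R]_n | [/\ chart_image p z.1, chart_image q z.2 &
         chart_dom r (param p z.1 * param q z.2)%g]]
      (fun z : 'rV[R]_n * 'rV[R]_n =>
         coord r (param p z.1 * param q z.2)%g) ;
  invg_continuous : continuous (fun a : G => (a^-1)%g) ;
  invg_smooth : forall p r : G,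
    smooth_on [set x | chart_image p x /\ chart_dom r (param p x)^-1%g]
      (fun x => coord r (param p x)^-1%g)
}.

#[short(type="lieGroupType")]
HB.structure Definition LieGroup (R : realType) (n : nat) :=
  {G of Manifold_isLieGroup R n G & Manifold R n G & Group G}.

Section LieGroups.
Context {R : realType} {n : nat} (G : lieGroupType R n).

Definition left_invariant_vf (X : G -> 'rV[R]_n) : Prop :=
  forall a b : G, X (a * b)%g = tangent_map (fun x => a * x)%g b (X b).

Definition lie_algebra : set (G -> 'rV[R]_n) :=
  [set X | smooth_vf X /\ left_invariant_vf X].

Definition lie_center : set (G -> 'rV[R]_n) :=
  [set X | lie_algebra X /\ forall Y, lie_algebra Y -> lie_bracket X Y = 0].

Definition two_step_nilpotent : Prop :=
  (exists X Y, [/\ lie_algebra X, lie_algebra Y & lie_bracket X Y <> 0]) /\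
  forall X Y Z, lie_algebra X -> lie_algebra Y -> lie_algebra Z ->
    lie_bracket X (lie_bracket Y Z) = 0.

Definition left_invariant_metric (g : G -> 'rV[R]_n -> 'rV[R]_n -> R) : Prop :=
  forall (a b : G) u v,
    g (a * b)%g (tangent_map (fun x => a * x)%g b u)
                (tangent_map (fun x => a * x)%g b v) = g b u v.

Definition left_invariant_finsler (F : G -> 'rV[R]_n -> R) : Prop :=
  forall (a : G) Y, F a Y = F 1%g (tangent_map (fun x => a^-1 * x)%g a Y).

(* X defines a left invariant Randers metric of Berwald type, with underlying *)
(* Riemannian metric g.                                                       *)
Definition left_invariant_berwald_randers
    (g : G -> 'rV[R]_n -> 'rV[R]_n -> R) (X : G -> 'rV[R]_n) : Prop :=
  [/\ randers_data g X, left_invariant_finsler (randers g X) & parallel g X].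

End LieGroups.

Arguments lie_algebra {R n} G _.
Arguments lie_center {R n} G _.
Arguments two_step_nilpotent {R n} G.

(* Main.v *)
Require Import Defs.
From HB Require Import structures.
From mathcomp Require Import all_boot all_order all_algebra.
From mathcomp Require Import all_classical all_reals all_analysis.
From mathcomp Require Import ring.
(* Again, so that coord is the chart map and not the coordinates of a vector
   in a basis. *)
Import Defs.
Set Implicit Arguments.
Unset Strict Implicit.
Unset Printing Implicit Defensive.
Import Order.TTheory GRing.Theory Num.Theory numFieldNormedType.Exports.
Local Open Scope classical_set_scope.
Local Open Scope ring_scope.

(** A left invariant Randers metric with left invariant underlying metric is
    given by a left invariant field [X]. On a two-step nilpotent group it is of
    Berwald type exactly if [X] is central and orthogonal to all brackets of left
    invariant fields ([berwald_randersP]).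

    If [X] is parallel for the Levi-Civita connection [D], then [D X Y] is the
    bracket of [X] and [Y], because the torsion vanishes and [D Y X = 0]. As
    inner products of left invariant fields are constant, [ad X] is then
    skew-symmetric, and [X] is orthogonal to [D Y Z - D Z Y], the bracket of [Y]
    and [Z] ([parallel_orthogonal]). Since [ad X] is skew-symmetric and squares
    to zero, it vanishes ([parallel_central]).

    Conversely, a Levi-Civita connection is constructed from a left invariant
    orthonormal frame with the Christoffel symbols of Koszul's formula
    ([frame_connection_levi_civita]). A central field orthogonal to the brackets
    makes all terms of that formula vanish ([central_orthogonal_parallel]). The
    frame and the structure constants come from two facts on Lie groups: each
    tangent vector at the unit extends to a smooth left invariant field
    ([left_field_smooth]), and brackets of left invariant fields are left
    invariant ([lie_bracket_left_invariant]), which rests on the symmetry of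
    second derivatives ([diff_diff_sym]).

    What remains is linear algebra in the tangent space at the unit: for a
    nonzero two-step nilpotent bracket in dimension five, a nonzero central
    vector orthogonal to the brackets exists if and only if the centre has
    dimension three ([center_orthogonal_exists],
    [center_orthogonal_dim]). In the adapted basis, these vectors are the
    combinations of [e4] and [e5]. *)

(** * Differentials of sums, products and composites *)

Section DiffAux.
Context {R : realType} {V W : normedModType R}.

Lemma is_diffE (f df : V -> W) x : is_diff x f df -> forall v, 'd f x v = df v.
Proof. by move=> d v; rewrite (diff_val (is_diff_def := d)). Qed.

(** The type of [is_diff] records its base point, so that a merely provable
    equality [f x = y] has to be substituted before the chain rule applies. *)
Lemma is_diff_comp_at (U : normedModType R) (f df : U -> V) (g dg : V -> W) x y :
  f x = y -> is_diff x f df -> is_diff y g dg -> is_diff x (g \o f) (dg \o df).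
Proof. by move=> <-; exact: is_diff_comp. Qed.

Lemma is_diff_near_eq (f g df : V -> W) x :
  (\near x, f x = g x) -> is_diff x f df -> is_diff x g df.
Proof.
move=> fg [fx dfE].
have fgx : f x = g x by exact: nbhs_singleton fg.
have H : g \o shift x = cst (g x) + 'd f x +o_ 0 id.
  have /diff_locally H := fx.
  apply/eqaddoP => e e0.
  have /eqaddoP/(_ e e0) := H; rewrite !near_simpl => He.
  have : \forall y \near 0, f (y + x) = g (y + x).
    have := fg; rewrite (near_shift 0 x)/=; apply: filterS => y.
    by rewrite /= subr0.
  move=> fg0; near=> y.
  have : `|(f \o shift x - (cst (f x) + 'd f x)) y| <= e * `|id y|.
    by near: y.
  rewrite /= -[X in `|X| <= _]/(f (y + x) - (f x + 'd f x y)).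
  rewrite -[X in _ -> `|X| <= _]/(g (y + x) - (g x + 'd f x y)) -fgx.
  by have -> : f (y + x) = g (y + x) by near: y.
have dg : 'd g x = 'd f x :> (V -> W).
  by apply: diff_unique => //; exact: diff_continuous.
split; last by rewrite dg.
apply/diff_locallyP; rewrite dg; split => //; exact: diff_continuous.
Unshelve. all: by end_near. Qed.

(** Leibniz' rule, from the differentiability of bounded bilinear maps. *)
Lemma is_diff_scale (k dk : V -> R) (f df : V -> W) x :
  is_diff x k dk -> is_diff x f df ->
  is_diff x (fun z => k z *: f z) (fun v => dk v *: f x + k x *: df v).
Proof.
move=> kx fx.
have bil : bilinear_for (GRing.Scale.Law.clone _ _ *:%R _)
   (GRing.Scale.Law.clone _ _ *:%R _) (@GRing.scale R W).
  split => [u'|u] a y z /=; first by rewrite scalerDl scalerA.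
  by rewrite scalerDr !scalerA mulrC.
pose sM := bilinear_isBilinear.Build R R W W _ _ (@GRing.scale R W) bil.
pose s : {bilinear R -> W -> W} := HB.pack (@GRing.scale R W) sM.
have sc : continuous (fun p : R * W => s p.1 p.2) by exact: scale_continuous.
have sd p : is_diff p (fun p : R * W => s p.1 p.2)
   (fun q => s p.1 q.2 + s q.1 p.2).
  split; first exact: (differentiable_bilin _ sc).
  exact: diff_bilin.
have := is_diff_comp (is_diff_pair kx fx) (sd (k x, f x)).
by congr (is_diff_def _ _ _); apply/funext => v /=; rewrite addrC.
Qed.

Lemma is_diff_sum I (r : seq I) (f df : I -> V -> W) x :
  (forall i, is_diff x (f i) (df i)) ->
  is_diff x (fun y => \sum_(i <- r) f i y) (fun v => \sum_(i <- r) df i v).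
Proof.
move=> fx; elim: r => [|i r IH].
  have := is_diff_cst (0 : W) x.
  by congr (is_diff_def _ _ _); apply/funext => v; rewrite big_nil.
have := is_diffD (fx i) IH.
by congr (is_diff_def _ _ _); apply/funext => v; rewrite big_cons.
Qed.

End DiffAux.

Lemma is_diff_coord (R : realType) n (i : 'I_n) (w : 'rV[R]_n) :
  is_diff w (fun w : 'rV[R]_n => w ord0 i) (fun w => w ord0 i).
Proof.
have lin : linear (fun w : 'rV[R]_n => w ord0 i) by move=> a u v; rewrite !mxE.
pose LM := GRing.isLinear.Build _ _ _ _ _ lin.
pose L : {linear 'rV[R]_n -> R} := HB.pack (fun w : 'rV[R]_n => w ord0 i) LM.
have Ld v : differentiable L v := differentiable_coord v ord0 i.
split; first exact: Ld.
by apply: (diff_lin (f := L)) => v; exact: differentiable_continuous.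
Qed.

(** * Closure properties of smooth maps *)

Section SmoothClosure.
Context {R : realType} {V : normedModType R}.
Implicit Types W : normedModType R.

Lemma Ck_on_eq W k (U : set V) (f g : V -> W) : open U ->
  (forall x, U x -> f x = g x) -> Ck_on k U f -> Ck_on k U g.
Proof.
move=> oU; elim: k f g => [|k IH] f g fg /=.
  move=> fc x Ux.
  have nU : \near x, f x = g x by apply: filterS (open_nbhs_nbhs (conj oU Ux)).
  rewrite /prop_for /continuous_at -(fg _ Ux).
  apply: cvg_trans (fc x Ux); exact: near_eq_cvg.
move=> [df cf]; have fgd x : U x -> is_diff x g ('d f x).
  move=> Ux; apply: (is_diff_near_eq (f := f)); last exact/differentiableP/df.
  by apply: filterS (open_nbhs_nbhs (conj oU Ux)).
split=> [x Ux|v]; first by have [] := fgd x Ux.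
apply: IH (cf v) => x Ux; have gd := fgd x Ux.
by rewrite [in RHS](is_diffE gd).
Qed.

Lemma Ck_on_sub W k (U U' : set V) (f : V -> W) : U' `<=` U ->
  Ck_on k U f -> Ck_on k U' f.
Proof.
move=> UU; elim: k f => [|k IH] f /=; first by move=> fc x /UU; exact: fc.
by move=> [df cf]; split=> [x /UU /df //|v]; exact: IH.
Qed.

Lemma Ck_on_prev W k (U : set V) (f : V -> W) :
  Ck_on k.+1 U f -> Ck_on k U f.
Proof.
elim: k f => [|k IH] f.
  by case=> df _ x /df; exact: differentiable_continuous.
by move=> [df cf]; split=> // v; exact/IH/cf.
Qed.

Lemma Ck_on_cst W k (U : set V) (a : W) : open U -> Ck_on k U (cst a).
Proof.
move=> oU; elim: k a => [|k IH] a /=; first by move=> x _; exact: cvg_cst.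
split=> [x _|v]; first exact: differentiable_cst.
by apply: (Ck_on_eq (f := cst 0)) (IH _) => // x _; rewrite diff_cst.
Qed.

Lemma Ck_onD W k (U : set V) (f g : V -> W) : open U ->
  Ck_on k U f -> Ck_on k U g -> Ck_on k U (f + g).
Proof.
move=> oU; elim: k f g => [|k IH] f g /=.
  by move=> fc gc x Ux; apply: continuousD; [exact: fc|exact: gc].
move=> [df cf] [dg cg]; split=> [x Ux|v].
  by apply: differentiableD; [exact: df|exact: dg].
apply: (Ck_on_eq (f := (fun x => 'd f x v) + (fun x => 'd g x v))) => //.
  by move=> x Ux; rewrite diffD//; [exact: df|exact: dg].
exact: IH.
Qed.

(** Each derivative of the product is a sum of two products of functions of
    class C^k, which closes the induction on [k]. *)
Lemma Ck_on_scale W k (U : set V) (f : V -> R) (g : V -> W) : open U ->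
  Ck_on k U f -> Ck_on k U g -> Ck_on k U (fun x => f x *: g x).
Proof.
move=> oU; elim: k f g => [|k IH] f g.
  by move=> fc gc x Ux; apply: (@cvgZ _ _ _ _ (nbhs_filter x)); [exact: fc|exact: gc].
move=> Cf Cg; have [df cf] := Cf; have [dg cg] := Cg.
have dfg x : U x -> is_diff x (fun x => f x *: g x)
   (fun v => 'd f x v *: g x + f x *: 'd g x v).
  move=> Ux; apply: is_diff_scale; apply: differentiableP;
    [exact: df|exact: dg].
split=> [x /dfg[]//|v].
apply: (Ck_on_eq (f := (fun x => 'd f x v *: g x) + (fun x => f x *: 'd g x v))) => //.
  by move=> x Ux; have d := dfg x Ux; rewrite [in RHS](is_diffE d).
apply: Ck_onD => //; apply: IH;
  by [exact: cf|exact: cg|exact: Ck_on_prev Cf|exact: Ck_on_prev Cg].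
Qed.

End SmoothClosure.

Section SmoothComposition.
Context {R : realType} {V : normedModType R}.
Implicit Types W : normedModType R.

(** The differential of an affine map is constant, so a fixed direction is sent
    to a fixed direction and the induction on [k] goes through. This serves to
    freeze one factor of the multiplication of a Lie group. *)
Lemma Ck_on_comp_affine (V' : normedModType R) W k (U : set V)
    (A : V' -> V) (L : V' -> V) (f : V -> W) : open U ->
  (forall x, is_diff x A L) ->
  Ck_on k U f -> Ck_on k (A @^-1` U) (f \o A).
Proof.
move=> oU AL; elim: k f => [|k IH] f.
  move=> fc x Ux; apply: continuous_comp; last exact: fc.
  by apply: differentiable_continuous; case: (AL x).
case=> [df cf]; have dfA x : U (A x) -> is_diff x (f \o A) ('d f (A x) \o L).
  by move=> Ux; apply: is_diff_comp; exact/differentiableP/df.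
have oAU : open (A @^-1` U).
  apply: open_comp => // x _; apply: differentiable_continuous.
  by case: (AL x).
split=> [x /dfA[]//|v]; apply: (Ck_on_eq oAU _ (IH _ (cf (L v)))) => x Ux.
by have d := dfA x Ux; rewrite [in RHS](is_diffE d).
Qed.

Lemma Ck_on_linear W (W' : normedModType R) k (U : set V) (L : W -> W')
    (f : V -> W) : open U -> (forall w, is_diff w L L) ->
  Ck_on k U f -> Ck_on k U (L \o f).
Proof.
move=> oU dL; elim: k f => [|k IH] f.
  move=> fc x Ux; apply: continuous_comp; first exact: fc.
  by apply: differentiable_continuous; case: (dL (f x)).
case=> [df cf]; have dfA x : U x -> is_diff x (L \o f) (L \o 'd f x).
  by move=> Ux; apply: is_diff_comp; exact/differentiableP/df.
split=> [x /dfA[]//|v]; apply: (Ck_on_eq oU _ (IH _ (cf v))) => x Ux.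
by have d := dfA x Ux; rewrite [in RHS](is_diffE d).
Qed.

Lemma smooth_on_eq W (U : set V) (f g : V -> W) : open U ->
  (forall x, U x -> f x = g x) -> smooth_on U f -> smooth_on U g.
Proof. by move=> oU fg sf k; exact: Ck_on_eq (sf k). Qed.

Lemma smooth_on_sub W (U U' : set V) (f : V -> W) : U' `<=` U ->
  smooth_on U f -> smooth_on U' f.
Proof. by move=> UU sf k; exact: Ck_on_sub (sf k). Qed.

Lemma smooth_on_cst W (U : set V) (a : W) : open U -> smooth_on U (cst a).
Proof. by move=> oU k; exact: Ck_on_cst. Qed.

Lemma smooth_onD W (U : set V) (f g : V -> W) : open U ->
  smooth_on U f -> smooth_on U g -> smooth_on U (f + g).
Proof. by move=> oU sf sg k; apply: Ck_onD; [|exact: sf|exact: sg]. Qed.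

Lemma smooth_on_scale W (U : set V) (f : V -> R) (g : V -> W) : open U ->
  smooth_on U f -> smooth_on U g -> smooth_on U (fun x => f x *: g x).
Proof.
by move=> oU sf sg k; apply: Ck_on_scale; [|exact: sf|exact: sg].
Qed.

Lemma smooth_on_sum W (U : set V) I (r : seq I) (f : I -> V -> W) : open U ->
  (forall i, smooth_on U (f i)) -> smooth_on U (fun x => \sum_(i <- r) f i x).
Proof.
move=> oU sf; elim: r => [|i r IH].
  by apply: (smooth_on_eq oU _ (smooth_on_cst 0 oU)) => x _; rewrite big_nil.
apply: (smooth_on_eq oU _ (smooth_onD oU (sf i) IH)) => x _.
by rewrite big_cons.
Qed.

Lemma smooth_on_diff W (U : set V) (f : V -> W) v :
  smooth_on U f -> smooth_on U (fun x => 'd f x v).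
Proof. by move=> sf k; have [_ df] := sf k.+1; exact: df. Qed.

Lemma smooth_on_differentiable W (U : set V) (f : V -> W) x :
  smooth_on U f -> U x -> differentiable f x.
Proof. by move=> sf Ux; have [df _] := sf 1; exact: df. Qed.

Lemma smooth_on_comp_affine (V' : normedModType R) W (U : set V)
    (A : V' -> V) (L : V' -> V) (f : V -> W) : open U ->
  (forall x, is_diff x A L) ->
  smooth_on U f -> smooth_on (A @^-1` U) (f \o A).
Proof. by move=> oU AL sf k; apply: (Ck_on_comp_affine oU AL); exact: sf. Qed.

Lemma smooth_on_coord n (U : set V) (f : V -> 'rV[R]_n) i : open U ->
  smooth_on U f -> smooth_on U (fun x => f x ord0 i).
Proof.
by move=> oU sf k; apply: (Ck_on_linear oU (is_diff_coord i)); exact: sf.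
Qed.

End SmoothComposition.

Section Rows.
Context {R : realType} {n : nat} {W : lmodType R}.

Lemma linear_row_sum (L : {linear 'rV[R]_n -> W}) v :
  L v = \sum_i v ord0 i *: L (delta_mx 0 i).
Proof.
rewrite {1}(row_sum_delta v) linear_sum; apply: eq_bigr => i _.
by rewrite linearZ.
Qed.

End Rows.

(** The direction varies with the point; its coordinates turn the derivative
    into a finite sum of products of smooth functions. *)
Lemma smooth_on_diff_field (R : realType) n (W : normedModType R)
    (U : set 'rV[R]_n) (f : 'rV[R]_n -> W) (X : 'rV[R]_n -> 'rV[R]_n) :
  open U -> smooth_on U f -> smooth_on U X -> smooth_on U (fun x => 'd f x (X x)).
Proof.
move=> oU sf sX.
apply: (smooth_on_eq (f := fun x => \sum_i X x ord0 i *: 'd f x (delta_mx 0 i))) => //.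
  by move=> x _; rewrite [in RHS]linear_row_sum.
apply: smooth_on_sum => // i; apply: smooth_on_scale => //.
  exact: smooth_on_coord.
exact: smooth_on_diff.
Qed.

(** Leibniz' rule for the pairing of the differential with a field; the second
    derivative of [f] that appears here is what Schwarz' theorem cancels in
    brackets. *)
Lemma is_diff_diff_field (R : realType) n (W : normedModType R)
    (U : set 'rV[R]_n) (f : 'rV[R]_n -> W) (X : 'rV[R]_n -> 'rV[R]_n) x :
  open U -> smooth_on U f -> differentiable X x -> U x ->
  is_diff x (fun x => 'd f x (X x))
    (fun v => 'd (fun y => 'd f y (X x)) x v + 'd f x ('d X x v)).
Proof.
move=> oU sf dX Ux.
have E : (fun x => 'd f x (X x)) =
    (fun x => \sum_i X x ord0 i *: 'd f x (delta_mx 0 i)).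
  by apply/funext => y; rewrite [LHS]linear_row_sum.
have dc (i : 'I_n) : is_diff x (fun y => X y ord0 i) (fun v => 'd X x v ord0 i).
  exact: (is_diff_comp (differentiableP dX) (is_diff_coord i (X x))).
have dd (i : 'I_n) : differentiable (fun y => 'd f y (delta_mx 0 i)) x.
  exact: smooth_on_differentiable (smooth_on_diff (delta_mx 0 i) sf) Ux.
have ds i := is_diff_scale (dc i) (differentiableP (dd i)).
rewrite E; have := is_diff_sum (index_enum 'I_n) ds.
congr (is_diff_def _ _ _).
apply/funext => v; rewrite big_split/= addrC; congr (_ + _).
  have E' : (fun y => 'd f y (X x)) =
     (fun y => \sum_i X x ord0 i *: 'd f y (delta_mx 0 i)).
    by apply/funext => y; rewrite [LHS]linear_row_sum.
  have ds' (i : 'I_n) := is_diffZ (X x ord0 i) (differentiableP (dd i)).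
  by rewrite E' [RHS](is_diffE (is_diff_sum _ ds')).
by rewrite [RHS]linear_row_sum.
Qed.

(** * Symmetry of second derivatives *)

Section Schwarz.
Context {R : realType} {V : normedModType R}.

Lemma is_diff_line (a w : V) (t : R) :
  is_diff t (fun t : R => a + t *: w) (fun t => t *: w).
Proof.
have := is_diffD (is_diff_cst a t) (is_diff_scalel t w).
by congr (is_diff_def _ _ _); apply/funext => s /=; rewrite add0r.
Qed.

Lemma MVT_line (f : V -> R) (a w : V) (h : R) : 0 < h ->
  (forall t, 0 <= t <= h -> differentiable f (a + t *: w)) ->
  exists2 c, 0 <= c <= h & f (a + h *: w) - f a = h * 'd f (a + c *: w) w.
Proof.
move=> h0 df.
have dg t : 0 <= t <= h ->
    is_diff t (fun t : R => f (a + t *: w)) (fun s => 'd f (a + t *: w) (s *: w)).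
  move=> th; exact: (is_diff_comp (is_diff_line a w t) (differentiableP (df t th))).
have [t||c] := MVT (f := fun t => f (a + t *: w))
   (df := fun t => 'd f (a + t *: w) w) h0.
- rewrite in_itv/= => /andP[t0 th].
  have d : is_diff t (fun t : R => f (a + t *: w)) (fun s => 'd f (a + t *: w) (s *: w)).
    by apply: dg; rewrite !ltW.
  apply: DeriveDef; first exact: diff_derivable.
  rewrite deriveE; last by case: d.
  by rewrite (is_diffE d) scale1r.
- apply: derivable_within_continuous => t; rewrite in_itv/= => th.
  by apply/derivable1_diffP; have [] := dg t th.
rewrite in_itv/= => /andP[c0 ch] E; exists c; first by rewrite !ltW.
by move: E; rewrite scale0r addr0 subr0 mulrC.
Qed.

(** Two uses of the mean value theorem: first along [u] for the increment of
    [f] by [h *: v], then along [v] for the derivative of [f] along [u]. The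
    continuity of the iterated derivative at [x] gives the estimate. *)
Lemma second_difference (U : set V) (f : V -> R) x u v e :
  open U -> Ck_on 2 U f -> U x -> 0 < e ->
  exists2 d, 0 < d & forall h, 0 < h < d ->
    `|f (x + h *: u + h *: v) - f (x + h *: u) - f (x + h *: v) + f x
        - h * h * 'd (fun y => 'd f y u) x v| <= e * (h * h).
Proof.
move=> oU [df Cdf] Ux e0; have [dfu /(_ v) Cuv] := Cdf u.
have [r r0 rU] : exists2 r, 0 < r & forall y, `|x - y| < r -> U y /\
    `|'d (fun y => 'd f y u) x v - 'd (fun y => 'd f y u) y v| < e.
  have /cvgrPdist_lt/(_ e e0) nA := Cuv x Ux.
  have /nbhs_ballP[r r0 rU] : nbhs x (U `&` [set y |
      `|'d (fun y => 'd f y u) x v - 'd (fun y => 'd f y u) y v| < e]).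
    by apply: filterI => //; exact: open_nbhs_nbhs.
  by exists r => // y xy; apply: rU; rewrite -ball_normE.
(* Every corner and inner point of the rectangle of side h < r / m is within
   distance r of x; the summand 1 covers the case u = v = 0. *)
pose m := `|u| + `|v| + 1.
have m0 : 0 < m by rewrite ltr_wpDl// addr_ge0.
exists (r / m); first exact: divr_gt0.
move=> h /andP[h0 hr].
have inU s t : 0 <= s <= h -> 0 <= t <= h -> `|x - (x + s *: u + t *: v)| < r.
  move=> /andP[s0 sh] /andP[t0 th].
  rewrite -addrA opprD addrA subrr sub0r normrN.
  apply: (@le_lt_trans _ _ (h * m)); last by rewrite -ltr_pdivlMr.
  rewrite !mulrDr mulr1 (le_trans (ler_normD _ _))// !normrZ !ger0_norm//.
  rewrite -[X in X <= _]addr0; apply: lerD; last exact: ltW.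
  by apply: lerD; apply: ler_wpM2r.
have hh : 0 <= h <= h by rewrite lexx ltW.
have zh : 0 <= (0:R) <= h by rewrite lexx ltW.
pose F y := f (y + h *: v) - f y.
have dF s : 0 <= s <= h -> is_diff (x + s *: u) F
  (fun w => 'd f (x + s *: u + h *: v) w - 'd f (x + s *: u) w).
  move=> sh.
  have d1 : is_diff (x + s *: u) (fun y => y + h *: v) id.
    have := is_diffD (is_diff_id (x + s *: u)) (is_diff_cst (h *: v) (x + s *: u)).
    by congr (is_diff_def _ _ _); apply/funext => w /=; rewrite addr0.
  have d2 := differentiableP (df _ (rU _ (inU s h sh hh)).1).
  have d3 : differentiable f (x + s *: u).
    by apply: df; have := rU _ (inU s 0 sh zh); rewrite scale0r addr0 => -[].
  exact: (is_diffB (is_diff_comp d1 d2) (differentiableP d3)).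
have [s sh Es] : exists2 c, 0 <= c <= h &
    F (x + h *: u) - F x = h * 'd F (x + c *: u) u.
  by apply: MVT_line => // t th; have [] := dF t th.
have [t th Et] : exists2 c, 0 <= c <= h &
    'd f (x + s *: u + h *: v) u - 'd f (x + s *: u) u
     = h * 'd (fun y => 'd f y u) (x + s *: u + c *: v) v.
  apply: (MVT_line (f := fun y => 'd f y u)) => // t th.
  apply: dfu; exact: (rU _ (inU s t sh th)).1.
have -> : f (x + h *: u + h *: v) - f (x + h *: u) - f (x + h *: v) + f x =
    F (x + h *: u) - F x.
  by rewrite /F opprB addrCA addrC -!addrA [- _ + f x]addrC.
rewrite Es (is_diffE (dF s sh)) Et mulrA -mulrBr normrM.
rewrite (ger0_norm (mulr_ge0 (ltW h0) (ltW h0))) [e * _]mulrC.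
rewrite ler_wpM2l ?mulr_ge0 ?ltW//.
by rewrite distrC; exact: (rU _ (inU s t sh th)).2.
Qed.

(** The second difference is symmetric in [u] and [v], so by
    [second_difference] both iterated derivatives approximate it to within
    [e * h ^+ 2]. *)
Lemma diff_diff_sym_real (U : set V) (f : V -> R) x u v :
  open U -> Ck_on 2 U f -> U x ->
  'd (fun y => 'd f y u) x v = 'd (fun y => 'd f y v) x u.
Proof.
move=> oU Cf Ux; set A := LHS; set B := RHS.
apply/eqP; rewrite -subr_eq0 -normr_le0; apply/ler_addgt0Pr => e e0.
have e20 : 0 < e / 2 by rewrite divr_gt0.
have [d d0 dA] := second_difference u v oU Cf Ux e20.
have [d' d'0 dB] := second_difference v u oU Cf Ux e20.
pose h := Num.min d d' / 2.
have h0 : 0 < h by rewrite divr_gt0 // lt_min d0.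
have hd : h < d /\ h < d'.
  have : h < Num.min d d' by rewrite /h ltr_pdivrMr// mulr_natr mulr2n ltrDl lt_min d0.
  by rewrite lt_min => /andP.
have hh0 : 0 < h * h by rewrite mulr_gt0.
have := dA h; rewrite h0 hd.1 => /(_ isT); rewrite -/A.
have := dB h; rewrite h0 hd.2 => /(_ isT); rewrite -/B.
rewrite [x + _ + _]addrAC.
set D := (X in `|X - _| <= _);
set D' := (X in _ -> `|X - _| <= _ -> _).
have -> : D' = D by congr (_ + _); exact: addrAC.
rewrite distrC => b; move=> a.
rewrite add0r -(ler_pM2r hh0) -[X in X * _ <= _]normrN.
rewrite -[X in _ * X <= _](gtr0_norm hh0) -normrM.
have -> : - (A - B) * (h * h) = (D - h * h * A) + (h * h * B - D).
  by ring.
rewrite (le_trans (ler_normD _ _))// [e]splitr mulrDl; exact: lerD.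
Qed.

End Schwarz.

(** Schwarz' theorem, coordinate by coordinate. *)
Lemma diff_diff_sym (R : realType) (V : normedModType R) n (U : set V)
    (f : V -> 'rV[R]_n) x u v :
  open U -> smooth_on U f -> U x ->
  'd (fun y => 'd f y u) x v = 'd (fun y => 'd f y v) x u.
Proof.
move=> oU sf Ux; apply/rowP => i.
pose fi y := f y ord0 i.
have dfi y : U y -> is_diff y fi (fun w => 'd f y w ord0 i).
  move=> Uy; have df := smooth_on_differentiable sf Uy.
  exact: (is_diff_comp (differentiableP df) (is_diff_coord i _)).
have ddfi w : is_diff x (fun y => 'd fi y w)
    (fun z => 'd (fun y => 'd f y w) x z ord0 i).
  have sdf := smooth_on_diff w sf.
  have ddf := smooth_on_differentiable sdf Ux.
  have d : is_diff x (fun y => 'd f y w ord0 i)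
      (fun z => 'd (fun y => 'd f y w) x z ord0 i).
    exact: (is_diff_comp (differentiableP ddf) (is_diff_coord i _)).
  apply: is_diff_near_eq d.
  apply: filterS (open_nbhs_nbhs (conj oU Ux)) => y Uy.
  by rewrite (is_diffE (dfi y Uy)).
have sfi : smooth_on U fi by exact: smooth_on_coord.
have := diff_diff_sym_real u v oU (sfi 2) Ux.
have Eu := diff_val (is_diff_def := ddfi u).
have Ev := diff_val (is_diff_def := ddfi v).
by rewrite Eu Ev.
Qed.

(** * Changes of charts *)

Section Charts.
Context {R : realType} {n : nat} {M : manifoldType R n}.
Implicit Types p q r m : M.

Lemma chart_image_coord p q : chart_dom p q -> chart_image p (coord p q).
Proof. by move=> pq; exists q. Qed.

Lemma chart_image_center p : chart_image p (coord p p).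
Proof. exact/chart_image_coord/chart_dom_center. Qed.

Lemma param_dom p x : chart_image p x -> chart_dom p (param p x).
Proof. by case=> q pq <-; rewrite coordK. Qed.

Lemma paramK p x : chart_image p x -> coord p (param p x) = x.
Proof. by case=> q pq <-; rewrite coordK. Qed.

Lemma chart_overlapE p q : coord p @` (chart_dom p `&` chart_dom q) =
  [set x | chart_image p x /\ chart_dom q (param p x)].
Proof.
apply/seteqP; split=> [_ [m [pm qm] <-]|x [px qx]] /=.
  by rewrite coordK//; split=> //; exact: chart_image_coord.
by exists (param p x); [split=> //; exact: param_dom|exact: paramK].
Qed.

Lemma open_chart_preimage (V : topologicalType) (F : V -> M) (A : set V) (B : set M) :
  open A -> (forall x, A x -> {for x, continuous F}) -> open B ->
  open [set x | A x /\ B (F x)].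
Proof.
move=> oA cF oB; rewrite openE => x [Ax BFx].
apply: filterI; first exact: open_nbhs_nbhs.
by apply: cF => //; exact: open_nbhs_nbhs.
Qed.

Lemma transition_smooth p q :
  smooth_on [set x | chart_image p x /\ chart_dom q (param p x)] (coord q \o param p).
Proof. by rewrite -chart_overlapE; exact: chart_compatible. Qed.

Lemma transition_differentiable p q m : chart_dom p m -> chart_dom q m ->
  differentiable (coord q \o param p) (coord p m).
Proof.
move=> pm qm; apply: smooth_on_differentiable (transition_smooth p q) _.
by split; [exact: chart_image_coord|rewrite coordK].
Qed.

(** The chain rule through the chart at [s]: near [x], [h \o F] is the composite
    of [h \o param s] and [coord s \o F], as [F] stays in the chart by
    continuity. *)
Lemma is_diff_chart (V W : normedModType R) (F : V -> M) (h : M -> W)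
    (dF : V -> 'rV[R]_n) (dh : 'rV[R]_n -> W) x s m :
  F x = m -> {for x, continuous F} -> chart_dom s m -> is_diff x (coord s \o F) dF ->
  is_diff (coord s m) (h \o param s) dh -> is_diff x (h \o F) (dh \o dF).
Proof.
move=> <- cF sF dFx dhx; have := is_diff_comp dFx dhx; apply: is_diff_near_eq.
have : \near x, chart_dom s (F x).
  by apply: cF; apply: open_nbhs_nbhs; split=> //; exact: chart_dom_open.
by apply: filterS => y sFy /=; rewrite coordK.
Qed.

Lemma transition_trans p q r m v :
  chart_dom p m -> chart_dom q m -> chart_dom r m ->
  'd (coord r \o param p) (coord p m) v =
  'd (coord r \o param q) (coord q m) ('d (coord q \o param p) (coord p m) v).
Proof.
move=> pm qm rm.
have /differentiableP d1 := transition_differentiable pm qm.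
have /differentiableP := transition_differentiable qm rm.
have pc : {for coord p m, continuous (param p)}.
  exact/param_continuous/chart_image_coord.
have mE : param p (coord p m) = m by rewrite coordK.
move=> d2; have d3 : is_diff (coord p m) (coord r \o param p)
    ('d (coord r \o param q) (coord q m) \o 'd (coord q \o param p) (coord p m)).
  exact: is_diff_chart mE pc qm d1 d2.
exact: is_diffE d3 _.
Qed.

Lemma transition_id p m v : chart_dom p m ->
  'd (coord p \o param p) (coord p m) v = v.
Proof.
move=> pm; have d : is_diff (coord p m) (coord p \o param p) id.
  apply: is_diff_near_eq (is_diff_id _).
  have : \forall x \near coord p m, chart_image p x.
    apply: open_nbhs_nbhs; split; first exact: chart_image_open.
    exact: chart_image_coord.
  by apply: filterS => x px /=; rewrite paramK.
exact: is_diffE d _.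
Qed.

Lemma to_chartK p q v : chart_dom p q -> from_chart p q (to_chart p q v) = v.
Proof.
move=> pq; have qq := chart_dom_center q.
by rewrite /from_chart /to_chart -transition_trans// transition_id.
Qed.

End Charts.

(** * Vector fields and functions in charts *)

Section VectorFields.
Context {R : realType} {n : nat} {M : manifoldType R n}.
Implicit Types (p q : M) (f : M -> R) (X Y Z : M -> 'rV[R]_n).

Lemma vf_local_center X p : vf_local X p (coord p p) = X p.
Proof.
have pp := chart_dom_center p.
by rewrite /vf_local coordK// /to_chart transition_id.
Qed.

Lemma vf_localD X Y p : vf_local (X + Y) p = vf_local X p + vf_local Y p.
Proof.
apply/funext => x; set q := param p x.
exact: (linearD ('d (coord p \o param q) (coord q q)) (X q) (Y q)).
Qed.

Lemma vf_local_scale f X p :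
  vf_local (vf_scale f X) p = (fun x => (f \o param p) x *: vf_local X p x).
Proof.
apply/funext => x; set q := param p x.
exact: (linearZZ ('d (coord p \o param q) (coord q q)) (f q) (X q)).
Qed.

Lemma vf_local0 p : vf_local (0 : M -> 'rV[R]_n) p = 0.
Proof.
apply/funext => x; set q := param p x.
exact: (linear0 ('d (coord p \o param q) (coord q q))).
Qed.

Lemma vf_local_sum I (r : seq I) (X : I -> M -> 'rV[R]_n) p :
  vf_local (\sum_(i <- r) X i) p = (fun x => \sum_(i <- r) vf_local (X i) p x).
Proof.
elim: r => [|i r IH]; first by
  rewrite big_nil vf_local0; apply/funext => x; rewrite big_nil.
by rewrite big_cons vf_localD IH; apply/funext => x; rewrite big_cons.
Qed.

Lemma smooth_funD f h : smooth_fun f -> smooth_fun h -> smooth_fun (f + h).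
Proof.
move=> sf sh p; apply: smooth_onD; [exact: chart_image_open|exact: sf|exact: sh].
Qed.

Lemma smooth_funM f h : smooth_fun f -> smooth_fun h -> smooth_fun (fun p => f p * h p).
Proof.
move=> sf sh p.
apply: (@smooth_on_scale _ _ R); [exact: chart_image_open|exact: sf|exact: sh].
Qed.

Lemma smooth_fun_cst (c : R) : smooth_fun (fun _ : M => c).
Proof. by move=> p; apply: smooth_on_cst; exact: chart_image_open. Qed.

Lemma smooth_fun_sum I (r : seq I) (f : I -> M -> R) :
  (forall i, smooth_fun (f i)) -> smooth_fun (fun p => \sum_(i <- r) f i p).
Proof.
move=> sf p; apply: (@smooth_on_sum _ _ R _ _ r (fun i => f i \o param p)).
  exact: chart_image_open.
by move=> i; exact: sf.
Qed.

Lemma smooth_vf0 : smooth_vf (0 : M -> 'rV[R]_n).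
Proof.
by move=> p; rewrite vf_local0; apply: smooth_on_cst; exact: chart_image_open.
Qed.

Lemma smooth_vfD X Y : smooth_vf X -> smooth_vf Y -> smooth_vf (X + Y).
Proof.
move=> sX sY p; rewrite vf_localD; apply: smooth_onD;
  [exact: chart_image_open|exact: sX|exact: sY].
Qed.

Lemma smooth_vf_scale f X : smooth_fun f -> smooth_vf X -> smooth_vf (vf_scale f X).
Proof.
move=> sf sX p; rewrite vf_local_scale; apply: smooth_on_scale;
  [exact: chart_image_open|exact: sf|exact: sX].
Qed.

Lemma smooth_vf_sum I (r : seq I) (X : I -> M -> 'rV[R]_n) :
  (forall i, smooth_vf (X i)) -> smooth_vf (\sum_(i <- r) X i).
Proof.
move=> sX; elim: r => [|i r IH]; first by rewrite big_nil; exact: smooth_vf0.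
by rewrite big_cons; exact: smooth_vfD.
Qed.

Lemma smooth_vfZ (c : R) X : smooth_vf X -> smooth_vf (c *: X).
Proof. exact/smooth_vf_scale/smooth_fun_cst. Qed.

Lemma smooth_fun_differentiable f p x : smooth_fun f -> chart_image p x ->
  differentiable (f \o param p) x.
Proof. by move=> sf; exact: smooth_on_differentiable. Qed.

Lemma smooth_vf_differentiable X p x : smooth_vf X -> chart_image p x ->
  differentiable (vf_local X p) x.
Proof. by move=> sf; exact: smooth_on_differentiable. Qed.

Lemma vf_deriv_local X f p x : smooth_fun f -> chart_image p x ->
  vf_deriv X f (param p x) = 'd (f \o param p) x (vf_local X p x).
Proof.
move=> sf px; rewrite /vf_deriv /vf_local; set q := param p x.
have pq : chart_dom p q := param_dom px.
have qq := chart_dom_center q.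
have d1 := differentiableP (transition_differentiable qq pq).
have d2 := differentiableP (smooth_fun_differentiable sf px).
have d3 : is_diff (coord q q) (f \o param q)
    ('d (f \o param p) x \o to_chart p q).
  have qc : {for coord q q, continuous (param q)}.
    exact/param_continuous/chart_image_center.
  rewrite -[X in is_diff X (f \o param p) _](paramK px) -/q in d2.
  exact: is_diff_chart (coordK _ _ _) qc pq d1 d2.
exact: is_diffE d3 _.
Qed.

(** In a chart, [X f] is the pairing of the differential of [f] with the local
    expression of [X]. *)
Lemma smooth_vf_deriv X f : smooth_vf X -> smooth_fun f -> smooth_fun (vf_deriv X f).
Proof.
move=> sX sf p;
apply: (smooth_on_eq (f := fun x => 'd (f \o param p) x (vf_local X p x))).
- exact: chart_image_open.
- by move=> x px; rewrite /= vf_deriv_local.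
- by apply: smooth_on_diff_field; [exact: chart_image_open|exact: sf|exact: sX].
Qed.

Lemma vf_derivD X f h : smooth_fun f -> smooth_fun h ->
  vf_deriv X (f + h) = vf_deriv X f + vf_deriv X h.
Proof.
move=> sf sh; apply/funext => p; have pp := chart_image_center p.
have d := is_diffD (differentiableP (smooth_fun_differentiable sf pp))
  (differentiableP (smooth_fun_differentiable sh pp)).
exact: is_diffE d _.
Qed.

Lemma vf_derivM X f h p : smooth_fun f -> smooth_fun h ->
  vf_deriv X (fun p => f p * h p) p = vf_deriv X f p * h p + f p * vf_deriv X h p.
Proof.
move=> sf sh; have pp := chart_image_center p.
have d := is_diff_scale (differentiableP (smooth_fun_differentiable sf pp))
  (differentiableP (smooth_fun_differentiable sh pp)).
rewrite [LHS](is_diffE d) /= coordK//; exact: chart_dom_center.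
Qed.

Lemma vf_deriv_cst X (c : R) : vf_deriv X (fun=> c) = 0.
Proof. by apply/funext => p; exact: is_diffE (is_diff_cst c _) _. Qed.

Lemma vf_deriv_sum X I (r : seq I) (f : I -> M -> R) p : (forall i, smooth_fun (f i)) ->
  vf_deriv X (fun p => \sum_(i <- r) f i p) p = \sum_(i <- r) vf_deriv X (f i) p.
Proof.
move=> sf; have pp := chart_image_center p.
have d i := differentiableP (smooth_fun_differentiable (sf i) pp).
exact: is_diffE (is_diff_sum r d) _.
Qed.

Lemma lie_bracketC X Y : lie_bracket X Y = - lie_bracket Y X.
Proof. by apply/funext => p; rewrite /lie_bracket -[RHS]/(- (_ - _)) opprB. Qed.

(** Both fields are expanded along [e]; the terms where a coefficient is
    differentiated separate from those with the brackets of [e]. *)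
Lemma lie_bracket_sum m (x y : 'I_m -> M -> R) (e : 'I_m -> M -> 'rV[R]_n) p :
  (forall i, smooth_fun (x i)) -> (forall i, smooth_fun (y i)) ->
  (forall i, smooth_vf (e i)) ->
  let X := \sum_i vf_scale (x i) (e i) in
  let Y := \sum_i vf_scale (y i) (e i) in
  lie_bracket X Y p = \sum_k (vf_deriv X (y k) p - vf_deriv Y (x k) p) *: e k p
     + \sum_i \sum_j (x i p * y j p) *: lie_bracket (e i) (e j) p.
Proof.
move=> sx sy se X Y; have pp := chart_image_center p.
have pK : param p (coord p p) = p by rewrite coordK//; exact: chart_dom_center.
have dsum (z : 'I_m -> M -> R) v : (forall i, smooth_fun (z i)) ->
   'd (vf_local (\sum_i vf_scale (z i) (e i)) p) (coord p p) v =
   \sum_k 'd (z k \o param p) (coord p p) v *: e k p +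
   \sum_k z k p *: 'd (vf_local (e k) p) (coord p p) v.
  move=> sz.
  have d k := is_diff_scale
    (differentiableP (smooth_fun_differentiable (sz k) pp))
    (differentiableP (smooth_vf_differentiable (se k) pp)).
  have ds := is_diff_sum (index_enum 'I_m) d.
  have -> : vf_local (\sum_i vf_scale (z i) (e i)) p =
      (fun w => \sum_i (z i \o param p) w *: vf_local (e i) p w).
    by rewrite vf_local_sum; under eq_fun do under eq_bigr do rewrite vf_local_scale.
  rewrite [LHS](is_diffE ds) -big_split/=.
  by apply: eq_bigr => k _; rewrite vf_local_center pK.
have XE (z : 'I_m -> M -> R) : (\sum_i vf_scale (z i) (e i)) p = \sum_i z i p *: e i p.
  by rewrite fct_sumE.
have dlin k (w : 'I_m -> R) :
    'd (vf_local (e k) p) (coord p p) (\sum_i w i *: e i p) =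
    \sum_i w i *: 'd (vf_local (e k) p) (coord p p) (e i p).
  rewrite [LHS]linear_sum; apply: eq_bigr => i _; exact: linearZZ.
pose dE k i := 'd (vf_local (e k) p) (coord p p) (e i p).
have E : lie_bracket X Y p =
   (\sum_k vf_deriv X (y k) p *: e k p + \sum_k \sum_i (x i p * y k p) *: dE k i)
   - (\sum_k vf_deriv Y (x k) p *: e k p + \sum_k \sum_i (y i p * x k p) *: dE k i).
  have bil (z w : 'I_m -> M -> R) : (forall i, smooth_fun (z i)) ->
     'd (vf_local (\sum_i vf_scale (z i) (e i)) p) (coord p p)
         ((\sum_i vf_scale (w i) (e i)) p) =
     \sum_k vf_deriv (\sum_i vf_scale (w i) (e i)) (z k) p *: e k p
      + \sum_k \sum_i (w i p * z k p) *: dE k i.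
    move=> sz; rewrite [LHS](dsum _ _ sz); congr (_ + _).
    apply: eq_bigr => k _; rewrite XE dlin scaler_sumr.
    by apply: eq_bigr => i _; rewrite scalerA mulrC.
  by congr (_ - _); exact: bil.
rewrite E opprD addrACA -sumrB; congr (_ + _).
  by apply: eq_bigr => k _; rewrite -scalerBl.
rewrite [X in X - _]exchange_big -sumrB; apply: eq_bigr => i _.
rewrite -sumrB; apply: eq_bigr => j _.
by rewrite [y j p * _]mulrC -scalerBr.
Qed.

End VectorFields.

(** * Left translations and left invariant fields *)

Section LeftTranslations.
Context {R : realType} {n : nat} {G : lieGroupType R n}.
Implicit Types (a b c p q r s t : G) (v : 'rV[R]_n) (X Y : G -> 'rV[R]_n).

Definition mulg_chart p q r : 'rV[R]_n * 'rV[R]_n -> 'rV[R]_n :=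
  fun z => coord r (param p z.1 * param q z.2)%g.

Definition mulg_chart_dom p q r : set ('rV[R]_n * 'rV[R]_n) :=
  [set z | [/\ chart_image p z.1, chart_image q z.2 &
     chart_dom r (param p z.1 * param q z.2)%g]].

Lemma open_mulg_chart_dom p q r : open (mulg_chart_dom p q r).
Proof.
have -> : mulg_chart_dom p q r =
   [set z | (chart_image p z.1 /\ chart_image q z.2) /\
     chart_dom r ((fun z => (param p z.1 * param q z.2)%g) z)].
  by apply/seteqP; split=> [z [? ? ?]|z [[? ?] ?]].
apply: (open_chart_preimage (A := fun z => chart_image p z.1 /\ chart_image q z.2)).
- have o1 : open (fst @^-1` chart_image p : set ('rV[R]_n * 'rV[R]_n)).
    by apply: open_comp; [move=> z _; exact: cvg_fst|exact: chart_image_open].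
  have o2 : open (snd @^-1` chart_image q : set ('rV[R]_n * 'rV[R]_n)).
    by apply: open_comp; [move=> z _; exact: cvg_snd|exact: chart_image_open].
  exact: openI o1 o2.
- move=> z [z1 z2].
  apply: (continuous_comp (f := fun z : _ * _ => (param p z.1, param q z.2))
    (g := fun z : G * G => (z.1 * z.2)%g)); last exact: mulg_continuous.
  apply: cvg_pair.
    apply: (continuous_comp (f := fst) (g := param p)); first exact: cvg_fst.
    exact: param_continuous.
  apply: (continuous_comp (f := snd) (g := param q)); first exact: cvg_snd.
  exact: param_continuous.
- exact: chart_dom_open.
Qed.

Lemma is_diff_pairl (x y : 'rV[R]_n) :
  is_diff x (fun x => (x, y)) (fun v => (v, 0)).
Proof. exact: is_diff_pair (is_diff_id x) (is_diff_cst y x). Qed.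

Lemma is_diff_pairr (x y : 'rV[R]_n) :
  is_diff y (fun y => (x, y)) (fun v => (0, v)).
Proof. exact: is_diff_pair (is_diff_cst x y) (is_diff_id y). Qed.

Definition translation_chart a s r : 'rV[R]_n -> 'rV[R]_n :=
  coord r \o (fun x => a * x)%g \o param s.

Definition translation_chart_dom a s r : set 'rV[R]_n :=
  [set x | chart_image s x /\ chart_dom r (a * param s x)%g].

Lemma translation_chart_smooth a s r :
  smooth_on (translation_chart_dom a s r) (translation_chart a s r).
Proof.
have aa := chart_dom_center a.
have := smooth_on_comp_affine (@open_mulg_chart_dom a s r)
  (fun y => is_diff_pairr (coord a a) y) (mulg_smooth a s r).
rewrite /translation_chart /comp /= coordK//; apply: smooth_on_sub.
move=> x [sx rx]; split=> //=; first exact: chart_image_center.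
by rewrite coordK.
Qed.

Lemma left_translation_continuous a s x : chart_image s x ->
  {for x, continuous (fun x => a * param s x)%g}.
Proof.
move=> sx; apply: (continuous_comp (f := fun x => (a, param s x))
    (g := fun z : G * G => (z.1 * z.2)%g)); last exact: mulg_continuous.
have c1 : (fun _ : 'rV[R]_n => a) @ x --> a.
  have c := @cvg_cst G a _ (nbhs x) _; exact: c.
have c2 : param s @ x --> param s x by exact: param_continuous.
exact: cvg_pair c1 c2.
Qed.

Lemma open_translation_chart_dom a s r : open (translation_chart_dom a s r).
Proof.
apply: open_chart_preimage; [exact: chart_image_open| |exact: chart_dom_open].
by move=> x; exact: left_translation_continuous.
Qed.

(** The differential at [b] of the left translation by [a], read in the charts
    at [s] and [r]. Changes of charts are the case [a = 1], tangent maps the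
    case [s = b], [r = a * b], so that the single chain rule
    [translation_diff_comp] covers all compositions of these. *)
Definition translation_diff a s r b : 'rV[R]_n -> 'rV[R]_n :=
  'd (translation_chart a s r) (coord s b).

Lemma is_diff_translation a s r b : chart_dom s b -> chart_dom r (a * b)%g ->
  is_diff (coord s b) (translation_chart a s r) (translation_diff a s r b).
Proof.
move=> sb rab; apply/differentiableP.
apply: smooth_on_differentiable (@translation_chart_smooth a s r) _.
by split; [exact: chart_image_coord|rewrite coordK].
Qed.

Lemma translation_diff_comp c a s t r b v :
  chart_dom s b -> chart_dom t (a * b)%g -> chart_dom r (c * a * b)%g ->
  translation_diff (c * a)%g s r b v =
  translation_diff c t r (a * b)%g (translation_diff a s t b v).
Proof.
move=> sb tab rcab.
have d1 := is_diff_translation sb tab.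
have rc : chart_dom r (c * (a * b))%g by rewrite mulgA.
have d2 := is_diff_translation tab rc.
have cF := @left_translation_continuous a _ _ (chart_image_coord sb).
have E : (a * param s (coord s b))%g = (a * b)%g by rewrite coordK.
have := is_diff_chart (h := coord r \o (fun x => c * x)%g) E cF tab d1 d2.
move=> d; apply: etrans (is_diffE d v); rewrite /translation_diff.
suff -> : translation_chart (c * a)%g s r =
   (coord r \o (fun x => c * x)%g) \o (fun x => a * param s x)%g by [].
by apply/funext => x; rewrite /translation_chart /= mulgA.
Qed.

Lemma translation_diff1 s r b :
  translation_diff 1%g s r b = 'd (coord r \o param s) (coord s b).
Proof.
rewrite /translation_diff.
suff -> : translation_chart 1%g s r = coord r \o param s by [].
by apply/funext => x; rewrite /translation_chart /= mul1g.
Qed.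

Lemma to_chartE p q : to_chart p q = translation_diff 1%g q p q.
Proof. by rewrite translation_diff1. Qed.

Lemma tangent_mapE a b :
  tangent_map (fun x => a * x)%g b = translation_diff a b (a * b)%g b.
Proof. by []. Qed.

(** The left invariant field with value [v] at the unit. *)
Definition left_field v : G -> 'rV[R]_n :=
  fun a => translation_diff a 1%g a 1%g v.

Lemma left_field_invariant v : left_invariant_vf (left_field v).
Proof.
move=> a b; rewrite /left_field tangent_mapE.
rewrite (translation_diff_comp (t := b)) ?mulg1//; exact: chart_dom_center.
Qed.

Lemma left_field1 v : left_field v 1%g = v.
Proof.
by rewrite /left_field translation_diff1 transition_id//; exact: chart_dom_center.
Qed.

Lemma left_invariant_fieldE X : left_invariant_vf X -> X = left_field (X 1%g).
Proof.
by move=> lX; apply/funext => a; have := lX a 1%g; rewrite tangent_mapE mulg1.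
Qed.

Lemma left_field_linear (c : R) v w :
  left_field (c *: v + w) = c *: left_field v + left_field w.
Proof. by apply/funext => a; exact: linearP. Qed.

(** In the charts at [p] and [1], the field at [a] is the partial derivative of
    [a * y] in [y] at [y = 1], so it is smooth in [a] because multiplication is. *)
Lemma left_field_smooth v : smooth_vf (left_field v).
Proof.
move=> p; have e1 := chart_dom_center (1%g : G).
have oI : open (chart_image p) by exact: chart_image_open.
pose S := mulg_chart_dom p 1%g p; pose y0 := coord (1%g : G) 1%g.
have Sx x : chart_image p x -> S (x, y0).
  move=> px; split=> //=; first exact: chart_image_center.
  by rewrite coordK// mulg1; exact: param_dom.
have oS : open S   := @open_mulg_chart_dom p 1%g p.
have sM : smooth_on S (mulg_chart p 1%g p) := mulg_smooth p 1%g p.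
have := smooth_on_comp_affine oS (is_diff_pairl^~ y0) (smooth_on_diff (0, v) sM).
move=> /(smooth_on_sub Sx); apply: smooth_on_eq => // x px.
rewrite /vf_local; set q := param p x; rewrite /left_field.
have pq : chart_dom p q by exact: param_dom.
have qq := chart_dom_center q.
rewrite to_chartE.
have -> : translation_diff 1%g q p q (translation_diff q 1%g q 1%g v) =
          translation_diff q 1%g p 1%g v.
  have := translation_diff_comp (c := 1%g) (a := q) (s := 1%g) (t := q)
    (r := p) (b := 1%g) v.
  by rewrite mul1g !mulg1 => ->.
have dM := differentiableP (smooth_on_differentiable sM (Sx _ px)).
have := is_diff_comp_at (erefl _) (is_diff_pairr x y0) dM => d.
exact/esym/(is_diffE d).
Qed.

Lemma lie_algebraP X : lie_algebra G X <-> X = left_field (X 1%g).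
Proof.
split=> [[_]|->]; first exact: left_invariant_fieldE.
by split; [exact: left_field_smooth|exact: left_field_invariant].
Qed.

Lemma lie_algebra_left_field v : lie_algebra G (left_field v).
Proof. by split; [exact: left_field_smooth|exact: left_field_invariant]. Qed.

(** A left invariant field is related to itself by left translations; this is
    that relation on a whole neighbourhood, as needed to differentiate it. *)
Lemma vf_local_translation X a b x : left_invariant_vf X ->
  translation_chart_dom a b (a * b)%g x ->
  vf_local X (a * b)%g (translation_chart a b (a * b)%g x) =
  'd (translation_chart a b (a * b)%g) x (vf_local X b x).
Proof.
move=> lX [bx abx]; rewrite /vf_local /translation_chart /= coordK//.
set m := param b x; rewrite lX tangent_mapE !to_chartE.
have mm := chart_dom_center m; have amm := chart_dom_center (a * m)%g.
have bm : chart_dom b m := param_dom bx.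
rewrite -translation_diff_comp ?mul1g//.
transitivity (translation_diff a b (a * b)%g m (translation_diff 1%g m b m (X m)));
  last by rewrite /translation_diff paramK.
have := translation_diff_comp (c := a) (a := 1%g) (s := m) (t := b)
  (r := (a * b)%g) (b := m) (X m).
by rewrite mulg1 !mul1g => ->.
Qed.

(** Differentiating [vf_local_translation] at [b] gives, besides the expected
    terms, the second derivative of the translation in the directions [X b] and
    [Y b]. It is symmetric and drops out of the bracket. *)
Lemma lie_bracket_left_invariant X Y :
  smooth_vf X -> left_invariant_vf X -> smooth_vf Y -> left_invariant_vf Y ->
  left_invariant_vf (lie_bracket X Y).
Proof.
move=> sX lX sY lY a b; rewrite tangent_mapE.
set f := translation_chart a b (a * b)%g; set x0 := coord b b.
set U := translation_chart_dom a b (a * b)%g.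
have oU : open U := @open_translation_chart_dom a b (a * b)%g.
have sf : smooth_on U f := @translation_chart_smooth a b (a * b)%g.
have bb := chart_dom_center b; have abab := chart_dom_center (a * b)%g.
have Ux0 : U x0 by split; [exact: chart_image_center|rewrite coordK].
have fx0 : f x0 = coord (a * b)%g (a * b)%g by rewrite /f /translation_chart /= coordK.
have H Z v : smooth_vf Z -> left_invariant_vf Z ->
    'd (vf_local Z (a * b)%g) (coord (a * b)%g (a * b)%g) ('d f x0 v) =
    'd (fun y => 'd f y (Z b)) x0 v + 'd f x0 ('d (vf_local Z b) x0 v).
  move=> sZ lZ.
  have dZ := smooth_vf_differentiable sZ (chart_image_center b).
  have dZ' := differentiableP
    (smooth_vf_differentiable sZ (chart_image_center (a * b)%g)).
  have df := differentiableP (smooth_on_differentiable sf Ux0).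
  have d1 := is_diff_comp_at fx0 df dZ'.
  have d2 := is_diff_diff_field oU sf dZ Ux0.
  have nU : \forall x \near x0, (vf_local Z (a * b)%g \o f) x = 'd f x (vf_local Z b x).
    apply: filterS (open_nbhs_nbhs (conj oU Ux0)) => x Ux.
    exact: vf_local_translation.
  have d3 := is_diff_near_eq nU d1.
  have E : vf_local Z b x0 = Z b by exact: vf_local_center.
  rewrite E in d2.
  exact: etrans (esym (is_diffE d3 v)) (is_diffE d2 v).
have E : lie_bracket X Y (a * b)%g =
   ('d (fun y => 'd f y (Y b)) x0 (X b) + 'd f x0 ('d (vf_local Y b) x0 (X b)))
 - ('d (fun y => 'd f y (X b)) x0 (Y b) + 'd f x0 ('d (vf_local X b) x0 (Y b))).
  rewrite /lie_bracket lX lY !tangent_mapE.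
  by congr (_ - _); exact: H.
have aux (u v w w' : 'rV[R]_n) : u = w -> (u + v) - (w + w') = v - w'.
  by move=> ->; rewrite opprD addrACA subrr add0r.
apply: etrans E _; apply: etrans (aux _ _ _ _ (diff_diff_sym _ _ oU sf Ux0)) _.
exact/esym/linearB.
Qed.

Lemma lie_bracket_lie_algebra X Y :
  lie_algebra G X -> lie_algebra G Y -> lie_algebra G (lie_bracket X Y).
Proof.
move=> [sX lX] [sY lY]; apply/lie_algebraP/left_invariant_fieldE.
exact: lie_bracket_left_invariant.
Qed.

End LeftTranslations.

(** * Inner products and orthonormal families *)

Section InnerProduct.
Context {R : realType} {n : nat}.
Implicit Types (B : 'rV[R]_n -> 'rV[R]_n -> R) (u v w : 'rV[R]_n).

(** The pointwise part of being a Riemannian metric. *)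
Definition inner_product B : Prop :=
  [/\ forall (a : R) u v w, B (a *: u + v) w = a * B u w + B v w,
      forall u v, B u v = B v u &
      forall u, u != 0 -> 0 < B u u].

Variables (B : 'rV[R]_n -> 'rV[R]_n -> R) (ipB : inner_product B).

Lemma ipC u v : B u v = B v u. Proof. by have [_ + _] := ipB. Qed.

Lemma ipDl u v w : B (u + v) w = B u w + B v w.
Proof. by have [lB _ _] := ipB; rewrite -[u]scale1r lB mul1r scale1r. Qed.

Lemma ip0l w : B 0 w = 0.
Proof. by apply: (addrI (B 0 w)); rewrite -ipDl !addr0. Qed.

Lemma ipZl a u w : B (a *: u) w = a * B u w.
Proof. by have [lB _ _] := ipB; rewrite -[a *: u]addr0 lB ip0l addr0. Qed.

Lemma ipNl u w : B (- u) w = - B u w.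
Proof. by rewrite -scaleN1r ipZl mulN1r. Qed.

Lemma ipBl u v w : B (u - v) w = B u w - B v w.
Proof. by rewrite ipDl ipNl. Qed.

Lemma ip_suml I (r : seq I) (u : I -> 'rV[R]_n) w :
  B (\sum_(i <- r) u i) w = \sum_(i <- r) B (u i) w.
Proof.
elim: r => [|i r IH]; first by rewrite !big_nil ip0l.
by rewrite !big_cons ipDl IH.
Qed.

Lemma ipDr u v w : B u (v + w) = B u v + B u w.
Proof. by rewrite ipC ipDl !(ipC _ u). Qed.

Lemma ipZr a u w : B u (a *: w) = a * B u w.
Proof. by rewrite ipC ipZl ipC. Qed.

Lemma ip0r u : B u 0 = 0. Proof. by rewrite ipC ip0l. Qed.

Lemma ip_sumr I (r : seq I) u (w : I -> 'rV[R]_n) :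
  B u (\sum_(i <- r) w i) = \sum_(i <- r) B u (w i).
Proof. by rewrite ipC ip_suml; apply: eq_bigr => i _; exact: ipC. Qed.

Lemma ip_eq0 u : (B u u == 0) = (u == 0).
Proof.
apply/eqP/eqP => [|->]; last exact: ip0l.
have [_ _ posB] := ipB; case: (eqVneq u 0) => // u0 Buu.
by have := posB u u0; rewrite Buu ltxx.
Qed.

Lemma ip_ge0 u : 0 <= B u u.
Proof.
have [_ _ posB] := ipB; case: (eqVneq u 0) => [->|/posB/ltW//].
by rewrite ip0l.
Qed.

Definition orthonormal_family m (e : 'I_m -> 'rV[R]_n) : Prop :=
  forall i j, B (e i) (e j) = (i == j)%:R.

Lemma ip_orthonormal m (e : 'I_m -> 'rV[R]_n) (c : 'I_m -> R) k :
  orthonormal_family e -> B (\sum_i c i *: e i) (e k) = c k.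
Proof.
move=> oe; rewrite ip_suml (bigD1 k)//= ipZl oe eqxx mulr1 big1 ?addr0// => i ik.
by rewrite ipZl oe (negbTE ik) mulr0.
Qed.

Lemma orthonormal_expand (e : 'I_n -> 'rV[R]_n) v :
  orthonormal_family e -> v = \sum_k B v (e k) *: e k.
Proof.
move=> oe; pose E : 'M[R]_n := \matrix_i e i.
have mulE (c : 'rV[R]_n) : c *m E = \sum_i c 0 i *: e i.
  by rewrite mulmx_sum_row; apply: eq_bigr => i _; rewrite rowK.
have fE : row_free E.
  apply/inj_row_free => c cE; apply/rowP => k; rewrite mxE.
  by rewrite -(ip_orthonormal (fun i => c 0 i) k oe) -mulE cE ip0l.
have /submxP[c vE] : (v <= E)%MS
  by apply: submx_full; rewrite row_full_unit -row_free_unit.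
rewrite {1}vE mulE; apply: eq_bigr => k _; congr (_ *: _).
by rewrite vE mulE ip_orthonormal.
Qed.

Lemma orthonormal_ext (e : 'I_n -> 'rV[R]_n) u v :
  orthonormal_family e -> (forall k, B u (e k) = B v (e k)) -> u = v.
Proof.
move=> oe uv; rewrite (orthonormal_expand u oe) (orthonormal_expand v oe).
by apply: eq_bigr => k _; rewrite uv.
Qed.

Lemma ip_expand (e : 'I_n -> 'rV[R]_n) u v :
  orthonormal_family e -> B u v = \sum_k B u (e k) * B v (e k).
Proof.
move=> oe; rewrite {1}(orthonormal_expand v oe) ip_sumr.
by apply: eq_bigr => k _; rewrite ipZr mulrC.
Qed.

(** A vector orthogonal to [m < n] given ones exists by counting
    dimensions; normalized, it extends an orthonormal family. *)
Lemma orthonormal_exists m : (m <= n)%N ->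
  exists e : 'I_m -> 'rV[R]_n, orthonormal_family e.
Proof.
elim: m => [_|m IH mn]; first by exists (fun=> 0) => -[].
have [e oe] := IH (ltnW mn).
pose A : 'M[R]_(n, m) := \matrix_(i, j) B (delta_mx 0 i) (e j).
have mulA (v : 'rV[R]_n) j : (v *m A) 0 j = B v (e j).
  rewrite mxE [in RHS](row_sum_delta v) ip_suml; apply: eq_bigr => i _.
  by rewrite mxE ipZl.
have : kermx A != 0.
  rewrite -mxrank_eq0 mxrank_ker subn_eq0 -ltnNge.
  exact: leq_ltn_trans (rank_leq_col _) mn.
case/rowV0Pn => v /sub_kermxP vA v0.
have [_ _ posB] := ipB; have Bv := posB v v0.
pose s := Num.sqrt (B v v); have s0 : s != 0 by rewrite gt_eqF ?sqrtr_gt0.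
have ve j : B v (e j) = 0 by rewrite -mulA vA mxE.
exists (fun i => if unlift ord_max i is Some j then e j else s^-1 *: v) => i j.
case: unliftP => [i'|] ->; case: unliftP => [j'|] ->.
- by rewrite oe (inj_eq lift_inj).
- by rewrite ipZr ipC ve mulr0 eq_sym (negbTE (neq_lift _ _)).
- by rewrite ipZl ve mulr0 (negbTE (neq_lift _ _)).
- rewrite ipZl ipZr eqxx mulrA -expr2 exprVn sqr_sqrtr ?ltW//.
  by rewrite mulVf// gt_eqF.
Qed.

End InnerProduct.

Lemma riemannian_ip (R : realType) n (M : manifoldType R n) g (p : M) :
  riemannian g -> inner_product (g p).
Proof. by case=> gl gs gp _; split=> *; [exact: gl|exact: gs|exact: gp]. Qed.

(** * Linear combinations in the Lie bracket *)

Section BracketLinearity.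
Context {R : realType} {n : nat} {M : manifoldType R n}.
Implicit Types X Y Z : M -> 'rV[R]_n.

Lemma lie_bracket_linearr (a : R) X Y Z : smooth_vf Y -> smooth_vf Z ->
  lie_bracket X (a *: Y + Z) = a *: lie_bracket X Y + lie_bracket X Z.
Proof.
move=> sY sZ; apply/funext => p; have pp := chart_image_center p.
have dY := differentiableP (smooth_vf_differentiable sY pp).
have dZ := differentiableP (smooth_vf_differentiable sZ pp).
have d := is_diffD (is_diffZ a dY) dZ.
have E : vf_local (a *: Y + Z) p = a *: vf_local Y p + vf_local Z p.
  by rewrite vf_localD; congr (_ + _); exact: (vf_local_scale (fun=> a)).
have E1 : 'd (vf_local (a *: Y + Z) p) (coord p p) (X p) =
   a *: 'd (vf_local Y p) (coord p p) (X p) + 'd (vf_local Z p) (coord p p) (X p).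
  by rewrite E; exact: is_diffE d _.
have E2 : 'd (vf_local X p) (coord p p) ((a *: Y + Z) p) =
   a *: 'd (vf_local X p) (coord p p) (Y p) + 'd (vf_local X p) (coord p p) (Z p).
  exact: linearP.
have aux (u v w z : 'rV[R]_n) : (a *: u + v) - (a *: w + z) = a *: (u - w) + (v - z).
  by rewrite opprD addrACA -scalerBr.
apply: etrans (aux _ _ _ _); congr (_ - _); [exact: E1|exact: E2].
Qed.

Lemma lie_bracket0r X : lie_bracket X 0 = 0.
Proof.
have := lie_bracket_linearr 1 X smooth_vf0 smooth_vf0.
rewrite scale1r addr0 scale1r => E; apply: (addrI (lie_bracket X 0)).
by rewrite addr0 -E.
Qed.

Lemma lie_bracket_sumr I (r : seq I) (a : I -> R) X (Y : I -> M -> 'rV[R]_n) :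
  (forall i, smooth_vf (Y i)) ->
  lie_bracket X (\sum_(i <- r) a i *: Y i) = \sum_(i <- r) a i *: lie_bracket X (Y i).
Proof.
move=> sY; elim: r => [|i r IH]; first by rewrite !big_nil lie_bracket0r.
rewrite !big_cons -IH lie_bracket_linearr//.
by apply: smooth_vf_sum => j; exact: smooth_vfZ.
Qed.

Lemma lie_bracket_suml I (r : seq I) (a : I -> R) X (Y : I -> M -> 'rV[R]_n) :
  (forall i, smooth_vf (Y i)) ->
  lie_bracket (\sum_(i <- r) a i *: Y i) X = \sum_(i <- r) a i *: lie_bracket (Y i) X.
Proof.
move=> sY; rewrite lie_bracketC lie_bracket_sumr// -sumrN.
by apply: eq_bigr => i _; rewrite [in RHS]lie_bracketC scalerN.
Qed.

End BracketLinearity.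

(** * The Levi-Civita connection of an orthonormal frame *)

Section Metric.
Context {R : realType} {n : nat} {M : manifoldType R n}.
Variables (g : M -> 'rV[R]_n -> 'rV[R]_n -> R) (rg : riemannian g).
Implicit Types X Y Z : M -> 'rV[R]_n.

Let ip p := riemannian_ip p rg.

(** In a chart the inner product is a sum of products of the coordinates of the
    fields with the coefficients of the metric. *)
Lemma smooth_vf_inner X Y : smooth_vf X -> smooth_vf Y -> smooth_fun (vf_inner g X Y).
Proof.
move=> sX sY p; have oI : open (chart_image p) by exact: chart_image_open.
pose G i j x := g (param p x) (from_chart p (param p x) (delta_mx 0 i))
                              (from_chart p (param p x) (delta_mx 0 j)).
have sG i j : smooth_on (chart_image p) (G i j) by have [_ _ _] := rg; exact.
apply: (@smooth_on_eq _ _ R _ (fun x => \sum_i \sum_j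
    vf_local X p x ord0 i *: (vf_local Y p x ord0 j *: G i j x))) => //.
  move=> x px; rewrite /= /vf_inner; set q := param p x.
  have pq : chart_dom p q by exact: param_dom.
  have fE (Z : M -> 'rV[R]_n) : Z q =
      \sum_i vf_local Z p x ord0 i *: from_chart p q (delta_mx 0 i).
    rewrite -{1}(to_chartK (Z q) pq).
    exact: (linear_row_sum ('d (coord q \o param p) (coord p q)) (vf_local Z p x)).
  rewrite [in RHS](fE X) [in RHS](fE Y) (ip_suml (ip q)); apply: eq_bigr => i _.
  rewrite (ip_sumr (ip q)); apply: eq_bigr => j _.
  by rewrite (ipZl (ip q)) (ipZr (ip q)).
apply: (@smooth_on_sum _ _ R) => // i.
apply: (@smooth_on_sum _ _ R) => // j.
apply: (@smooth_on_scale _ _ R) => //; first exact: smooth_on_coord (sX p).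
apply: (@smooth_on_scale _ _ R) => //; exact: smooth_on_coord (sY p).
Qed.

Variable e : 'I_n -> M -> 'rV[R]_n.
Hypothesis se : forall i, smooth_vf (e i).
Hypothesis oe : forall p, orthonormal_family (g p) (e^~ p).
Variable c : 'I_n -> 'I_n -> 'I_n -> R.
Hypothesis cE : forall i j k p, g p (lie_bracket (e i) (e j) p) (e k p) = c i j k.

Let cf X k : M -> R := vf_inner g X (e k).

Let cC i j k (p : M) : c i j k = - c j i k.
Proof. by rewrite -!(cE _ _ _ p) lie_bracketC -(ipNl (ip p)). Qed.

(** Christoffel symbols of the frame, from the Koszul formula. *)
Definition christoffel i j k : R := (c i j k - c j k i + c k i j) / 2.

(** The frame is orthonormal, so the inner products with it are the coordinates
    of a field: the coordinates of [Y] are differentiated along [X], and the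
    frame contributes its Christoffel symbols. *)
Definition frame_connection X Y : M -> 'rV[R]_n :=
  \sum_k vf_scale (fun p => vf_deriv X (cf Y k) p +
     \sum_i \sum_j christoffel i j k * (cf X i p * cf Y j p)) (e k).

Let smooth_cf X k : smooth_vf X -> smooth_fun (cf X k).
Proof. by move=> sX; exact: smooth_vf_inner. Qed.

Lemma frame_connection_coef X Y k p :
  g p (frame_connection X Y p) (e k p) = vf_deriv X (cf Y k) p +
     \sum_i \sum_j christoffel i j k * (cf X i p * cf Y j p).
Proof.
rewrite /frame_connection fct_sumE.
exact: (ip_orthonormal (ip p) _ k (oe p)).
Qed.

Let field_ext X Y : (forall p k, g p (X p) (e k p) = g p (Y p) (e k p)) -> X = Y.
Proof.
by move=> XY; apply/funext => p; exact: (orthonormal_ext (ip p) (oe p)).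
Qed.

Let field_expand X : X = \sum_k vf_scale (cf X k) (e k).
Proof.
apply: field_ext => p k; rewrite fct_sumE.
by rewrite [RHS](ip_orthonormal (ip p) _ k (oe p)).
Qed.

Lemma frame_connection_smooth X Y : smooth_vf X -> smooth_vf Y ->
  smooth_vf (frame_connection X Y).
Proof.
move=> sX sY; apply: smooth_vf_sum => k; apply: smooth_vf_scale => //.
apply: smooth_funD; first by apply: smooth_vf_deriv => //; exact: smooth_cf.
apply: smooth_fun_sum => i; apply: smooth_fun_sum => j.
apply: smooth_funM; first exact: smooth_fun_cst.
by apply: smooth_funM; exact: smooth_cf.
Qed.

Lemma frame_connection_affine : affine_connection frame_connection.
Proof.
split; first exact: frame_connection_smooth.
- move=> X X' Y sX sX' sY; apply: field_ext => p k.
  rewrite (ipDl (ip p)) !frame_connection_coef addrACA -big_split; congr (_ + _).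
    exact: linearD.
  apply: eq_bigr => i _; rewrite -big_split; apply: eq_bigr => j _ /=.
  by rewrite /cf /vf_inner (ipDl (ip p)) mulrDl mulrDr.
- move=> f X Y sf sX sY; apply: field_ext => p k.
  rewrite (ipZl (ip p)) !frame_connection_coef mulrDr; congr (_ + _).
    exact: linearZ.
  rewrite mulr_sumr; apply: eq_bigr => i _; rewrite mulr_sumr; apply: eq_bigr => j _.
  by rewrite /cf /vf_inner (ipZl (ip p)); ring.
- move=> X Y Y' sX sY sY'; apply: field_ext => p k.
  rewrite (ipDl (ip p)) !frame_connection_coef addrACA -big_split; congr (_ + _).
    rewrite -[RHS]/((vf_deriv X (cf Y k) + vf_deriv X (cf Y' k)) p).
    rewrite -vf_derivD; do ?exact: smooth_cf.
    congr (vf_deriv _ _ _); apply/funext => q; exact: (ipDl (ip q)).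
  apply: eq_bigr => i _; rewrite -big_split; apply: eq_bigr => j _ /=.
  by rewrite /cf /vf_inner (ipDl (ip p)) mulrDr mulrDr.
- move=> f X Y sf sX sY; apply: field_ext => p k.
  rewrite (ipDl (ip p)) !(ipZl (ip p)) !frame_connection_coef mulrDr addrA.
  congr (_ + _).
    rewrite -[RHS]/(vf_deriv X f p * cf Y k p + f p * vf_deriv X (cf Y k) p).
    apply: etrans _ (vf_derivM _ _ sf (smooth_cf k sY)).
    congr (vf_deriv _ _ _); apply/funext => q; exact: (ipZl (ip q)).
  rewrite mulr_sumr; apply: eq_bigr => i _; rewrite mulr_sumr; apply: eq_bigr => j _.
  by rewrite /cf /vf_inner (ipZl (ip p)); ring.
Qed.

(** By Koszul's formula the antisymmetrization of [christoffel i j k] in [i]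
    and [j] is the structure constant [c i j k]. *)
Lemma frame_connection_torsion X Y : smooth_vf X -> smooth_vf Y ->
  frame_connection X Y - frame_connection Y X = lie_bracket X Y.
Proof.
move=> sX sY; apply: field_ext => p k.
rewrite (ipBl (ip p)) !frame_connection_coef.
have sc Z i : smooth_vf Z -> smooth_fun (cf Z i) by exact: smooth_cf.
have := lie_bracket_sum p (fun i => sc X i sX) (fun i => sc Y i sY) se.
rewrite /= -!field_expand => ->.
rewrite (ipDl (ip p)) (ip_orthonormal (ip p) _ k (oe p)).
rewrite opprD addrACA; congr (_ + _).
rewrite [X in _ - X]exchange_big -sumrB (ip_suml (ip p)); apply: eq_bigr => i _.
rewrite -sumrB (ip_suml (ip p)); apply: eq_bigr => j _.
rewrite (ipZl (ip p)) cE /christoffel (cC j i k p) (cC i k j p) (cC k j i p).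
by field.
Qed.

(** The terms without derivatives cancel because [christoffel i j k] is
    antisymmetric in [j] and [k]. *)
Lemma frame_connection_metric X Y Z : smooth_vf X -> smooth_vf Y -> smooth_vf Z ->
  vf_deriv X (vf_inner g Y Z) =
  vf_inner g (frame_connection X Y) Z + vf_inner g Y (frame_connection X Z).
Proof.
move=> sX sY sZ; apply/funext => p.
have -> : vf_inner g Y Z = (fun p => \sum_k cf Y k p * cf Z k p).
  by apply/funext => q; exact: (ip_expand (ip q) _ _ (oe q)).
rewrite vf_deriv_sum; last by move=> k; apply: smooth_funM; exact: smooth_cf.
rewrite -[RHS]/(g p (frame_connection X Y p) (Z p) +
  g p (Y p) (frame_connection X Z p)).
rewrite !(ip_expand (ip p) _ _ (oe p)) -big_split/=.
apply: etrans (eq_bigr _ (fun k _ =>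
  vf_derivM X p (smooth_cf k sY) (smooth_cf k sZ))) _.
pose T k := vf_deriv X (cf Y k) p * cf Z k p + cf Y k p * vf_deriv X (cf Z k) p.
have -> : \sum_(k < n) (vf_deriv X (cf Y k) p * cf Z k p +
    cf Y k p * vf_deriv X (cf Z k) p) =
  \sum_(k < n) T k +
  \sum_k \sum_i \sum_j christoffel i j k * (cf X i p * cf Y j p * cf Z k p +
      cf X i p * cf Y k p * cf Z j p).
  rewrite -[LHS]addr0; congr (_ + _).
  rewrite exchange_big big1//= => i _.
  under eq_bigr => k _ do (under eq_bigr => j _ do rewrite mulrDr; rewrite big_split/=).
  rewrite big_split/= [X in _ + X]exchange_big/= -big_split big1//= => k _.
  rewrite -big_split big1//= => j _.
  rewrite /christoffel (cC k j i p) (cC i k j p) (cC j i k p).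
  by field.
rewrite -big_split; apply: eq_bigr => k _ /=.
rewrite !frame_connection_coef mulrDl mulrDr addrACA; congr (_ + _).
rewrite mulr_suml mulr_sumr -big_split; apply: eq_bigr => i _ /=.
rewrite mulr_suml mulr_sumr -big_split; apply: eq_bigr => j _ /=.
rewrite -[g p (Z p) (e k p)]/(cf Z k p) -[g p (Y p) (e k p)]/(cf Y k p).
by ring.
Qed.

Lemma frame_connection_levi_civita : levi_civita g frame_connection.
Proof.
split; [exact: frame_connection_affine|exact: frame_connection_torsion|].
exact: frame_connection_metric.
Qed.

(** A field with constant coordinates has only the Christoffel terms in its
    covariant derivative. *)
Lemma frame_parallel X (a : 'I_n -> R) : smooth_vf X ->
  (forall k p, g p (X p) (e k p) = a k) ->
  (forall i k, \sum_j christoffel i j k * a j = 0) ->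
  parallel g X.
Proof.
move=> sX Xa aE; split=> //; exists frame_connection.
  exact: frame_connection_levi_civita.
move=> Y sY; apply: field_ext => p k; rewrite frame_connection_coef (ip0l (ip p)).
have -> : cf X k = (fun=> a k) by apply/funext => q; exact: Xa.
rewrite vf_deriv_cst add0r big1// => i _.
transitivity (cf Y i p * \sum_j christoffel i j k * a j); last by rewrite aE mulr0.
rewrite mulr_sumr; apply: eq_bigr => j _; rewrite mulrCA.
by rewrite -[cf X j p]/(g p (X p) (e j p)) Xa.
Qed.

End Metric.

(** * Centres of skew-symmetric brackets *)

Lemma row_base_rank (F : fieldType) m n (A : 'M[F]_(m, n)) k : \rank A = k ->
  exists2 S : 'M[F]_(k, n), row_free S & (S :=: A)%MS.
Proof.
by move=> <-; exists (row_base A); [exact: row_base_free|exact: eq_row_base].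
Qed.

Section SkewBrackets.
Context {R : realType} {n : nat}.
Variable B : 'rV[R]_n -> 'rV[R]_n -> 'rV[R]_n.
Hypothesis linB : forall (a : R) u v w, B u (a *: v + w) = a *: B u v + B u w.
Hypothesis altB : forall u v, B u v = - B v u.
Implicit Types u v w : 'rV[R]_n.

Lemma alt0r u : B u 0 = 0.
Proof.
apply: (addrI (B u 0)); rewrite addr0.
by have := linB 1 u 0 0; rewrite !scale1r addr0 => <-.
Qed.

Lemma altDr u v w : B u (v + w) = B u v + B u w.
Proof. by have := linB 1 u v w; rewrite !scale1r. Qed.

Lemma altZr a u v : B u (a *: v) = a *: B u v.
Proof. by have := linB a u v 0; rewrite alt0r !addr0. Qed.

Lemma altDl u v w : B (u + v) w = B u w + B v w.
Proof. by rewrite altB altDr opprD -!altB. Qed.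

Lemma altZl a u v : B (a *: u) v = a *: B u v.
Proof. by rewrite altB altZr -scalerN -altB. Qed.

Lemma alt_diag u : B u u = 0.
Proof.
have /eqP := altB u u; rewrite -addr_eq0 -mulr2n -scaler_nat scaler_eq0.
by rewrite pnatr_eq0 => /eqP.
Qed.

Lemma alt_sumr I (r : seq I) (v : I -> 'rV[R]_n) u :
  B u (\sum_(i <- r) v i) = \sum_(i <- r) B u (v i).
Proof.
elim: r => [|i r IH]; first by rewrite !big_nil alt0r.
by rewrite !big_cons altDr IH.
Qed.

Lemma alt_suml I (r : seq I) (v : I -> 'rV[R]_n) u :
  B (\sum_(i <- r) v i) u = \sum_(i <- r) B (v i) u.
Proof.
by rewrite altB alt_sumr -sumrN; apply: eq_bigr => i _; rewrite -altB.
Qed.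

(** The centre is a subspace, so it is the row space of a matrix. *)
Lemma center_mx_exists : exists Z : 'M[R]_n,
  forall v, (v <= Z)%MS <-> forall w, B v w = 0.
Proof.
pose f (v : 'rV[R]_n) := mxvec (\matrix_(j < n) B v (delta_mx 0 j)).
have linf : linear f.
  move=> a u v; rewrite /f -linearP; congr mxvec; apply/matrixP => j k.
  by rewrite !mxE altDl altZl !mxE.
pose fM := GRing.isLinear.Build _ _ _ _ _ linf.
pose fL : {linear 'rV[R]_n -> 'rV[R]_(n * n)} := HB.pack f fM.
exists (kermx (lin1_mx fL)) => v; split=> [/sub_kermxP|vZ].
  rewrite mul_rV_lin1 /= => fv w; rewrite (row_sum_delta w) alt_sumr big1// => j _.
  rewrite altZr; suff -> : B v (delta_mx 0 j) = 0 by rewrite scaler0.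
  have := congr1 vec_mx fv; rewrite mxvecK linear0 => /(congr1 (row j)).
  by rewrite rowK row0.
apply/sub_kermxP; rewrite mul_rV_lin1 /= /f.
by rewrite (_ : \matrix_j _ = 0) ?linear0//; apply/row_matrixP => j; rewrite rowK row0.
Qed.

Variables (Z : 'M[R]_n) (ZE : forall v, (v <= Z)%MS <-> forall w, B v w = 0).

(** The bracket does not see the component of a vector in the centre, so only a
    basis of a complement matters. *)
Lemma complement_basis k : (\rank Z + k)%N = n -> exists A : 'M[R]_(k, n),
  [/\ row_free A, (A :&: Z = 0)%MS &
     forall v, exists c : 'rV[R]_k, forall w, B v w = B (c *m A) w].
Proof.
move=> Zk; have rC : \rank (Z^C)%MS = k.
  by rewrite mxrank_compl -[X in (X - _)%N]Zk addKn.
have [A fA AE] := row_base_rank rC.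
exists A; split=> //.
  apply/eqP; rewrite -submx0 capmxC; apply: submx_trans (_ : (Z :&: Z^C <= 0)%MS).
    by apply: capmxS => //; rewrite AE.
  by rewrite capmx_compl.
move=> v; have : (v <= Z + Z^C)%MS by apply: submx_full; exact: addsmx_compl_full.
case/sub_addsmxP => -[u1 u2] /= ->.
have /submxP[c cE] : (u2 *m (Z^C)%MS <= A)%MS by rewrite AE; exact: submxMl.
exists c => w; rewrite altDl cE; have /ZE -> : (u1 *m Z <= Z)%MS by exact: submxMl.
by rewrite add0r.
Qed.

Lemma alt_mul k (A : 'M[R]_(k, n)) (c d : 'rV[R]_k) :
  B (c *m A) (d *m A) = \sum_i \sum_j (c 0 i * d 0 j) *: B (row i A) (row j A).
Proof.
rewrite [c *m A]mulmx_sum_row alt_suml; apply: eq_bigr => i _.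
rewrite altZl [d *m A]mulmx_sum_row alt_sumr scaler_sumr; apply: eq_bigr => j _.
by rewrite altZr scalerA.
Qed.

Lemma alt_complement k (A : 'M[R]_(k, n)) u v :
  (forall v, exists c : 'rV[R]_k, forall w, B v w = B (c *m A) w) ->
  exists c d : 'rV[R]_k,
    B u v = \sum_i \sum_j (c 0 i * d 0 j) *: B (row i A) (row j A).
Proof.
move=> AB; have [c cE] := AB u; have [d dE] := AB v; exists c, d.
by rewrite -alt_mul cE altB dE -altB.
Qed.

Variables (P : 'rV[R]_n -> 'rV[R]_n -> R) (ipP : inner_product P).

(** A plane with an orthogonal basis [x], [w] contains no nonzero vector
    orthogonal to both. *)
Lemma sub_line_orthogonal (A : 'M[R]_n) x w z :
  \rank A = 2%N -> (x <= A)%MS -> (w <= A)%MS -> (z <= A)%MS ->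
  x != 0 -> w != 0 -> P x w = 0 -> P x z = 0 -> P z w = 0 -> z = 0.
Proof.
move=> rA xA wA zA x0 w0 xw xz zw.
pose V : 'M[R]_(2, n) := \matrix_i (if i == 0 then x else w).
have mulV (c : 'rV[R]_2) : c *m V = c 0 0 *: x + c 0 1 *: w.
  rewrite mulmx_sum_row big_ord_recl big_ord1 !rowK /=.
  by congr (_ + c _ _ *: _); exact: val_inj.
have VA : (V <= A)%MS by apply/row_subP => i; rewrite rowK; case: ifP.
have fV : row_free V.
  apply/inj_row_free => c; rewrite mulV => cV.
  have c0 : c 0 0 = 0.
    have := congr1 (P^~ x) cV; rewrite (ipDl ipP) !(ipZl ipP) (ipC ipP w) xw.
    rewrite mulr0 addr0 (ip0l ipP) => /eqP.
    by rewrite mulf_eq0 (ip_eq0 ipP) (negbTE x0) orbF => /eqP.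
  have c1 : c 0 1 = 0.
    have := congr1 (P^~ w) cV; rewrite (ipDl ipP) !(ipZl ipP) xw.
    rewrite mulr0 add0r (ip0l ipP) => /eqP.
    by rewrite mulf_eq0 (ip_eq0 ipP) (negbTE w0) orbF => /eqP.
  apply/rowP => i; rewrite mxE.
  by case: i => -[|[|//]] i2;
    [rewrite -[RHS]c0|rewrite -[RHS]c1]; congr (c _ _); apply: val_inj.
have AV : (A <= V)%MS.
  have /andP[_ //] : (V == A)%MS.
  by rewrite -(geq_leqif (mxrank_leqif_eq VA)) rA;
    move: fV; rewrite /row_free => /eqP ->.
have /submxP[c] := submx_trans zA AV; rewrite mulV => zE.
have Pzz : P z z = 0.
  by rewrite {2}zE (ipDr ipP) !(ipZr ipP) (ipC ipP z x) xz zw !mulr0 addr0.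
by apply/eqP; rewrite -(ip_eq0 ipP) Pzz.
Qed.

End SkewBrackets.

(** * Two-step nilpotent brackets in dimension five *)

Section DimensionFive.
Context {R : realType}.
Variable B : 'rV[R]_5 -> 'rV[R]_5 -> 'rV[R]_5.
Hypothesis linB : forall (a : R) u v w, B u (a *: v + w) = a *: B u v + B u w.
Hypothesis altB : forall u v, B u v = - B v u.
Hypothesis nilB : forall u v w, B u (B v w) = 0.
Hypothesis nonabB : exists u v, B u v <> 0.
Variables (P : 'rV[R]_5 -> 'rV[R]_5 -> R) (ipP : inner_product P).
Variables (Z : 'M[R]_5) (ZE : forall v, (v <= Z)%MS <-> forall w, B v w = 0).

(** A complement of the centre is spanned by two vectors, so all brackets are
    multiples of a single one. Orthogonality to it is one linear condition on
    the three-dimensional centre. *)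
Lemma center_orthogonal_exists : \rank Z = 3%N ->
  exists x, [/\ x != 0, (x <= Z)%MS & forall u v, P x (B u v) = 0].
Proof.
move=> rZ.
have [A [_ _ AB]] := complement_basis linB altB ZE (k := 2) (congr1 (addn^~ 2) rZ).
pose w := B (row 0 A) (row 1 A).
have [S fS SE] := row_base_rank rZ.
pose F : 'cV[R]_3 := \col_i P (row i S) w.
have : kermx F != 0.
  rewrite -mxrank_eq0 mxrank_ker subn_eq0 -ltnNge.
  exact: leq_ltn_trans (rank_leq_col _) _.
case/rowV0Pn => c /sub_kermxP cF c0; exists (c *m S); split.
- by apply: contraNneq c0 => cS; apply/eqP/(row_free_inj fS); rewrite /= cS mul0mx.
- by rewrite -SE submxMl.
have Pw : P (c *m S) w = 0.
  have /rowP/(_ 0) := cF; rewrite !mxE mulmx_sum_row (ip_suml ipP) => E.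
  by apply: etrans E; apply: eq_bigr => i _; rewrite (ipZl ipP) mxE.
move=> u v; have [c1 [c2 ->]] := alt_complement linB altB u v AB.
rewrite !big_ord_recl !big_ord0 !addr0 !(alt_diag altB) !scaler0 add0r addr0.
have -> : lift ord0 ord0 = 1 :> 'I_2 by exact: val_inj.
rewrite (altB (row 1 A)) -/w (ipDr ipP) scalerN -scaleNr !(ipZr ipP) Pw.
by rewrite !mulr0 addr0.
Qed.

(** A nonzero bracket [w] is central and orthogonal to [x], so the centre has
    dimension at least 2; if it had dimension 4 or 5, the complement would be
    too small for a nonzero bracket. In dimension 2 all brackets would lie on
    the line of [w], and the bracket would be a skew-symmetric form on a
    complement of dimension 3. Such a form has a nonzero kernel, which would be
    central. *)
Lemma center_orthogonal_dim x : x != 0 -> (x <= Z)%MS ->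
  (forall u v, P x (B u v) = 0) -> \rank Z = 3%N.
Proof.
move=> x0 xZ xB; have [u [v /eqP w0]] := nonabB; set w := B u v in w0.
have BZ a b : (B a b <= Z)%MS by apply/ZE => d; rewrite altB nilB oppr0.
have wZ : (w <= Z)%MS by exact: BZ.
have xw : P x w = 0 by exact: xB.
have r5 : (\rank Z <= 5)%N by exact: rank_leq_row.
have rk k : (\rank Z + k = 5)%N -> exists A : 'M[R]_(k, 5),
    [/\ row_free A, (A :&: Z = 0)%MS &
     forall v, exists c : 'rV[R]_k, forall w, B v w = B (c *m A) w].
  exact: complement_basis.
have neq5 : \rank Z != 5%N.
  apply: contra_neq w0 => r; have [|A [_ _ AB]] := rk 0; first by rewrite r.
  by rewrite /w; have [c [d ->]] := alt_complement linB altB u v AB; rewrite big_ord0.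
have neq4 : \rank Z != 4%N.
  apply: contra_neq w0 => r; have [|A [_ _ AB]] := rk 1; first by rewrite r.
  rewrite /w; have [c [d ->]] := alt_complement linB altB u v AB.
  by rewrite !big_ord1 (alt_diag altB) scaler0.
have neq0 : \rank Z != 0%N.
  rewrite mxrank_eq0; apply: contraNneq x0 => Z0.
  by move: xZ; rewrite Z0 submx0.
have neq1 : \rank Z != 1%N.
  apply/eqP => r; have /andP[_ Zx] : (x == Z)%MS.
    by rewrite -(geq_leqif (mxrank_leqif_eq xZ)) r rank_rV x0.
  have /sub_rVP[a wE] := submx_trans wZ Zx.
  move: xw; rewrite wE (ipZr ipP) => /eqP.
  rewrite mulf_eq0 (ip_eq0 ipP) (negbTE x0) orbF.
  by move=> /eqP a0; rewrite wE a0 scale0r eqxx in w0.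
have neq2 : \rank Z != 2%N.
  apply/eqP => r; have [|A [fA AZ AB]] := rk 3; first by rewrite r.
  pose om a b := P (B a b) w.
  have om0 a b : om a b = 0 -> B a b = 0.
    by move=> o; apply: (sub_line_orthogonal ipP r xZ wZ (BZ a b) x0 w0).
  pose a1 := row 0 A; pose a2 := row 1 A; pose a3 := row 2 A.
  (* The kernel of a nonzero skew-symmetric form in dimension 3 is spanned by the
     vector whose coordinates are its three values on a basis. *)
  pose c : 'rV[R]_3 := \row_i (if i == 0 then om a2 a3
    else if i == 1 then om a3 a1 else om a1 a2).
  have mulA (d : 'rV[R]_3) : d *m A = d 0 0 *: a1 + d 0 1 *: a2 + d 0 2 *: a3.
    rewrite mulmx_sum_row !big_ord_recl big_ord0 addr0 addrA.
    have i1 : lift ord0 ord0 = 1 :> 'I_3 by exact: val_inj.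
    have i2 : lift ord0 (lift ord0 ord0) = 2 :> 'I_3 by exact: val_inj.
    by rewrite i1 i2.
  have omC a b : om a b = - om b a by rewrite /om altB (ipNl ipP).
  have omdiag a : om a a = 0 by rewrite /om (alt_diag altB) (ip0l ipP).
  have omc b : om (c *m A) b =
      om a2 a3 * om a1 b + om a3 a1 * om a2 b + om a1 a2 * om a3 b.
    rewrite mulA !mxE /=; rewrite /om !(altDl linB altB) !(altZl linB altB).
    by rewrite !(ipDl ipP) !(ipZl ipP).
  have cZ : (c *m A <= Z)%MS.
    apply/ZE => b; have [d dE] := AB b.
    rewrite altB dE -altB; apply: om0.
    have -> : om (c *m A) (d *m A) = d 0 0 * om (c *m A) a1 + d 0 1 * om (c *m A) a2
        + d 0 2 * om (c *m A) a3.
      rewrite [in LHS](mulA d) {1}/om !(altDr linB) !(altZr linB).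
      by rewrite !(ipDl ipP) !(ipZl ipP).
    rewrite !omc !omdiag (omC a2 a1) (omC a3 a2) (omC a3 a1); ring.
  have cA0 : c *m A = 0.
    by apply/eqP; rewrite -submx0 -AZ sub_capmx submxMl cZ.
  have c0 : c = 0 by apply: (row_free_inj fA); rewrite /= cA0 mul0mx.
  have o23 : om a2 a3 = 0 by have /rowP/(_ 0) := c0; rewrite !mxE.
  have o31 : om a3 a1 = 0 by have /rowP/(_ 1) := c0; rewrite !mxE.
  have o12 : om a1 a2 = 0 by have /rowP/(_ 2) := c0; rewrite !mxE.
  suff BA i j : B (row i A) (row j A) = 0.
    move/eqP: w0; apply; rewrite /w.
    have [c1 [c2 ->]] := alt_complement linB altB u v AB.
    by rewrite big1// => i _; rewrite big1// => j _; rewrite BA scaler0.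
  have rowE (l : 'I_3) : [\/ row l A = a1, row l A = a2 | row l A = a3].
    case: l => -[|[|[|//]]] i3; [apply: Or31|apply: Or32|apply: Or33];
    by congr (row _ _); apply: val_inj.
  apply: om0; have [->|->|->] := rowE i; have [->|->|->] := rowE j;
    by rewrite ?omdiag ?o12 ?o23 ?o31// omC ?o12 ?o23 ?o31 oppr0.
by move: r5 neq0 neq1 neq2 neq4 neq5; case: (\rank Z) => [|[|[|[|[|[|?]]]]]].
Qed.

End DimensionFive.

(** * The Lie algebra of a Lie group with a left invariant metric *)

Lemma is_basis_mem (R : realType) (V : lmodType R) (S : set V) k (b : k.-tuple V) i :
  is_basis S b -> S (tnth b i).
Proof.
case=> _ ->; exists (fun j => (j == i)%:R).
rewrite (bigD1 i)//= eqxx scale1r big1 ?addr0// => j /negbTE ->.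
by rewrite scale0r.
Qed.

Section LieAlgebra.
Context {R : realType} {n : nat} {N : lieGroupType R n}.
Implicit Types (X Y Z Q : N -> 'rV[R]_n) (u v : 'rV[R]_n).

Lemma left_field0 : left_field 0 = 0 :> (N -> 'rV[R]_n).
Proof. by apply/funext => a; exact: linear0. Qed.

Lemma left_field_sum I (r : seq I) (c : I -> R) (v : I -> 'rV[R]_n) :
  left_field (\sum_(i <- r) c i *: v i) =
  \sum_(i <- r) c i *: left_field (v i) :> (N -> 'rV[R]_n).
Proof.
elim: r => [|i r IH]; first by rewrite !big_nil left_field0.
by rewrite !big_cons left_field_linear IH.
Qed.

Lemma lie_algebra_sum I (r : seq I) (c : I -> R) (X : I -> N -> 'rV[R]_n) :
  (forall i, lie_algebra N (X i)) -> lie_algebra N (\sum_(i <- r) c i *: X i).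
Proof.
move=> lX.
have -> : \sum_(i <- r) c i *: X i = left_field (\sum_(i <- r) c i *: X i 1%g).
  by rewrite left_field_sum; apply: eq_bigr => i _; congr (_ *: _); apply/lie_algebraP.
exact: lie_algebra_left_field.
Qed.

Lemma lie_center_sum I (r : seq I) (c : I -> R) (X : I -> N -> 'rV[R]_n) :
  (forall i, lie_center N (X i)) -> lie_center N (\sum_(i <- r) c i *: X i).
Proof.
move=> cX; split; first by apply: lie_algebra_sum => i; case: (cX i).
move=> Y lY; rewrite lie_bracket_suml => [|i]; last by have [[]] := cX i.
by rewrite big1// => i _; have [_ ->//] := cX i; rewrite scaler0.
Qed.

(** The Lie bracket of [lie_algebra N], transported to the tangent space at the
    unit along [left_field]. *)
Definition unit_bracket u v : 'rV[R]_n :=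
  lie_bracket (left_field u) (left_field v) (1%g : N).

Lemma lie_bracket_left_field u v :
  lie_bracket (left_field u) (left_field v) =
  left_field (unit_bracket u v) :> (N -> 'rV[R]_n).
Proof.
by apply/lie_algebraP/lie_bracket_lie_algebra; exact: lie_algebra_left_field.
Qed.

Lemma unit_bracket_linear (a : R) u v w :
  unit_bracket u (a *: v + w) = a *: unit_bracket u v + unit_bracket u w.
Proof.
rewrite /unit_bracket left_field_linear lie_bracket_linearr//; exact: left_field_smooth.
Qed.

Lemma unit_bracketC u v : unit_bracket u v = - unit_bracket v u.
Proof. by rewrite /unit_bracket lie_bracketC. Qed.

Lemma two_step_unit_bracket : two_step_nilpotent N ->
  (exists u v, unit_bracket u v <> 0) /\
  forall u v w, unit_bracket u (unit_bracket v w) = 0.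
Proof.
case=> [[X [Y [lX lY XY]]] nil]; split=> [|u v w].
  exists (X 1%g), (Y 1%g) => E; apply: XY.
  move/lie_algebraP: lX => ->; move/lie_algebraP: lY => ->.
  by rewrite lie_bracket_left_field E left_field0.
rewrite /unit_bracket -lie_bracket_left_field nil//; exact: lie_algebra_left_field.
Qed.

Section Center.
Variables (Z : 'M[R]_n).
Hypothesis ZE : forall v, (v <= Z)%MS <-> forall w, unit_bracket v w = 0.

Lemma lie_center_left_field v : lie_center N (left_field v) <-> (v <= Z)%MS.
Proof.
split=> [[_ cv]|/ZE vZ].
  by apply/ZE => w; rewrite /unit_bracket cv//; exact: lie_algebra_left_field.
split; first exact: lie_algebra_left_field.
by move=> Y /lie_algebraP ->; rewrite lie_bracket_left_field vZ left_field0.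
Qed.

Lemma lie_centerP X : lie_center N X <-> X = left_field (X 1%g) /\ (X 1%g <= Z)%MS.
Proof.
split=> [cX|[XE XZ]]; last by rewrite XE; apply/lie_center_left_field.
have XE : X = left_field (X 1%g) by apply/lie_algebraP; case: cX.
by split=> //; apply/lie_center_left_field; rewrite -XE.
Qed.

(** Evaluation at the unit identifies the central fields with the row space
    of [Z]. *)
Lemma has_dim_lie_center k : has_dim (lie_center N) k <-> \rank Z = k.
Proof.
split=> [[b bb]|/row_base_rank[S fS SE]].
  pose V : 'M[R]_(k, n) := \matrix_i tnth b i 1%g.
  have bE i : tnth b i = left_field (tnth b i 1%g) /\ (tnth b i 1%g <= Z)%MS.
    by apply/lie_centerP; exact: is_basis_mem.
  have mulV (c : 'rV[R]_k) : c *m V = \sum_i c 0 i *: tnth b i 1%g.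
    by rewrite mulmx_sum_row; apply: eq_bigr => i _; rewrite rowK.
  have bV (c : 'I_k -> R) : \sum_i c i *: tnth b i = left_field ((\row_i c i) *m V).
    rewrite mulV left_field_sum; apply: eq_bigr => i _.
    by rewrite mxE {1}(bE i).1.
  have fV : row_free V.
    apply/inj_row_free => c cV; apply/rowP => i; rewrite mxE.
    have [free_b _] := bb; apply: (free_b (fun i => c 0 i)).
    by rewrite bV (_ : \row_i c 0 i = c) ?cV ?left_field0//;
      apply/rowP => j; rewrite mxE.
  have VZ : (V <= Z)%MS by apply/row_subP => i; rewrite rowK; case: (bE i).
  have ZV : (Z <= V)%MS.
    apply/row_subP => i; have : lie_center N (left_field (row i Z)).
      exact/lie_center_left_field/row_sub.
    have [_ ->] := bb; move=> [c]; rewrite bV => /(congr1 (@^~ 1%g)).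
    by rewrite /= !left_field1 => ->; exact: submxMl.
  have /eqmxP-> : (Z == V)%MS by rewrite ZV VZ.
  exact/eqP.
exists [tuple left_field (row i S) | i < k]; split.
  move=> c; under eq_bigr do rewrite tnth_mktuple.
  rewrite -left_field_sum => /(congr1 (@^~ 1%g)) /=; rewrite left_field1.
  have -> : \sum_i c i *: row i S = (\row_i c i) *m S.
    by rewrite mulmx_sum_row; apply: eq_bigr => i _; rewrite mxE.
  move=> cS i; have /rowP/(_ i) : \row_i c i = 0.
    by apply: (row_free_inj fS); rewrite /= mul0mx; exact: cS.
  by rewrite !mxE.
apply/seteqP; split=> [X /lie_centerP[XE]|X [c ->]].
  rewrite -SE => /submxP[c cE]; exists (fun i => c 0 i).
  under eq_bigr do rewrite tnth_mktuple.
  by rewrite XE cE mulmx_sum_row left_field_sum.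
under eq_bigr do rewrite tnth_mktuple.
rewrite -left_field_sum; apply/lie_center_left_field.
by apply: summx_sub => i _; rewrite scalemx_sub// -SE row_sub.
Qed.

End Center.

Variable g : N -> 'rV[R]_n -> 'rV[R]_n -> R.
Hypotheses (rg : riemannian g) (lg : left_invariant_metric g).

Let ip p := riemannian_ip p rg.

Lemma vf_inner_left_invariant X Y p : left_invariant_vf X -> left_invariant_vf Y ->
  g p (X p) (Y p) = g 1%g (X 1%g) (Y 1%g).
Proof.
by move=> lX lY; have := lg p 1%g (X 1%g) (Y 1%g); rewrite -lX -lY mulg1.
Qed.

Lemma vf_deriv_inner_left_invariant X Y Z :
  left_invariant_vf Y -> left_invariant_vf Z ->
  vf_deriv X (vf_inner g Y Z) = 0.
Proof.
move=> lY lZ; have -> : vf_inner g Y Z = (fun=> g 1%g (Y 1%g) (Z 1%g)).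
  by apply/funext => p; exact: vf_inner_left_invariant.
exact: vf_deriv_cst.
Qed.

(** Both [D Y Z] and [D Z Y] are orthogonal to a parallel field, as the metric
    is constant on left invariant fields; the bracket is their difference. *)
Lemma parallel_orthogonal X Y Z p : lie_algebra N X -> parallel g X ->
  lie_algebra N Y -> lie_algebra N Z -> g p (X p) (lie_bracket Y Z p) = 0.
Proof.
move=> [sX lX] [_ [D [_ torD metD] DX]] [sY lY] [sZ lZ].
have H U V : smooth_vf U -> smooth_vf V -> left_invariant_vf V ->
    g p (X p) (D U V p) = 0.
  move=> sU sV lV; have := metD U X V sU sX sV.
  rewrite vf_deriv_inner_left_invariant// DX// => /(congr1 (@^~ p)).
  rewrite -[RHS]/(g p 0 (V p) + g p (X p) (D U V p)) (ip0l (ip p)) add0r => <-.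
  by [].
rewrite -torD// -[(_ - _) p]/(D Y Z p - D Z Y p).
rewrite (ipDr (ip p)) (ipC (ip p) _ (- _)) (ipNl (ip p)).
by rewrite (ipC (ip p) _ (X p)) !H// subr0.
Qed.

(** If [X] is parallel, then [D X Y] is the bracket of [X] and [Y] since the
    torsion vanishes, so [ad X] is skew-symmetric. With [W = ad X Y], the square
    of the length of [W] is the negative of the product of [Y] and [ad X W],
    and [ad X W = 0] by two-step nilpotency. *)
Lemma parallel_central X Y : two_step_nilpotent N -> lie_algebra N X -> parallel g X ->
  lie_algebra N Y -> lie_bracket X Y = 0.
Proof.
move=> [_ nil] lieX [_ [D [_ torD metD] DX]] lieY.
have [sX lX] := lieX; have [sY lY] := lieY.
have DE V : smooth_vf V -> D X V = lie_bracket X V.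
  by move=> sV; rewrite -torD// DX// subr0.
have lieW := lie_bracket_lie_algebra lieX lieY; have [sW lW] := lieW.
apply/funext => p; have := metD X _ _ sX sY sW.
rewrite vf_deriv_inner_left_invariant// !DE// nil// => /(congr1 (@^~ p)).
rewrite -[RHS]/(g p (lie_bracket X Y p) (lie_bracket X Y p) + g p (Y p) 0).
rewrite (ip0r (ip p)) addr0 => /esym/eqP; rewrite (ip_eq0 (ip p)) => /eqP.
exact.
Qed.

(** In a left invariant orthonormal frame, Koszul's formula expresses the
    derivatives of [X] through [ad X] and the products of [X] with brackets. *)
Lemma central_orthogonal_parallel X : lie_center N X ->
  (forall Y Z, lie_algebra N Y -> lie_algebra N Z ->
     g 1%g (X 1%g) (lie_bracket Y Z 1%g) = 0) -> parallel g X.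
Proof.
move=> [lieX cX] oX; have [sX lX] := lieX.
have [u ou] := orthonormal_exists (ip 1%g) (leqnn n).
pose e i : N -> 'rV[R]_n := left_field (u i).
have le i : lie_algebra N (e i) := lie_algebra_left_field (u i).
have se i : smooth_vf (e i) by case: (le i).
have lle i : left_invariant_vf (e i) by case: (le i).
have oe p : orthonormal_family (g p) (e^~ p).
  move=> i j; apply: etrans (vf_inner_left_invariant p (lle i) (lle j)) _.
  by rewrite /e !left_field1 ou.
pose c i j k := g 1%g (lie_bracket (e i) (e j) 1%g) (e k 1%g).
have cE i j k p : g p (lie_bracket (e i) (e j) p) (e k p) = c i j k.
  apply: vf_inner_left_invariant; last exact: lle.
  by have [] := lie_bracket_lie_algebra (le i) (le j).
pose a k := g 1%g (X 1%g) (e k 1%g).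
have XE : X = \sum_j a j *: e j.
  rewrite -left_field_sum (left_invariant_fieldE lX); congr left_field.
  by rewrite [LHS](orthonormal_expand (ip 1%g) _ ou);
    apply: eq_bigr => j _; rewrite /a /e left_field1.
have aE k p : g p (X p) (e k p) = a k by exact: vf_inner_left_invariant (lle k).
suff aG i k : \sum_j christoffel c i j k * a j = 0.
  by have H := frame_parallel rg se oe cE sX aE aG; exact: H.
have s1 : \sum_j a j * c i j k = 0.
  transitivity (g 1%g (lie_bracket (e i) X 1%g) (e k 1%g)).
    rewrite {1}XE lie_bracket_sumr// fct_sumE (ip_suml (ip _)).
    by apply: eq_bigr => j _; rewrite (ipZl (ip _)).
  by rewrite lie_bracketC cX// oppr0 (ip0l (ip _)).
have s2 : \sum_j a j * c j k i = 0.
  transitivity (g 1%g (lie_bracket X (e k) 1%g) (e i 1%g)).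
    rewrite {1}XE lie_bracket_suml// fct_sumE (ip_suml (ip _)).
    by apply: eq_bigr => j _; rewrite (ipZl (ip _)).
  by rewrite cX// (ip0l (ip _)).
have s3 : \sum_j a j * c k i j = 0.
  rewrite -[RHS](oX (e k) (e i) (le k) (le i)) {1}XE fct_sumE (ip_suml (ip _)).
  by apply: eq_bigr => j _; rewrite (ipZl (ip _)) /c (ipC (ip _)).
transitivity ((\sum_j a j * c i j k - \sum_j a j * c j k i + \sum_j a j * c k i j) / 2).
  rewrite -sumrB -big_split mulr_suml; apply: eq_bigr => j _ /=.
  by rewrite /christoffel; field.
by rewrite s1 s2 s3 subrr addr0 mul0r.
Qed.

(** The Riemannian part of a Randers metric is left invariant, so the remaining
    linear part is too; it determines [X] because the metric is nondegenerate. *)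
Lemma left_invariant_finslerP X :
  left_invariant_finsler (randers g X) <-> left_invariant_vf X.
Proof.
have gT a u v : g 1%g (tangent_map (fun x => a^-1 * x)%g a u)
     (tangent_map (fun x => a^-1 * x)%g a v) = g a u v.
  by have := lg a^-1%g a u v; rewrite mulVg.
have XT Y a : left_invariant_vf Y -> Y 1%g = tangent_map (fun x => a^-1 * x)%g a (Y a).
  by move=> lY; have := lY a^-1%g a; rewrite mulVg.
split=> [FX|lX]; last first.
  by move=> a u; rewrite /randers gT (XT X a lX) gT.
suff -> : X = left_field (X 1%g) by exact: left_field_invariant.
apply/funext => a; set L := left_field (X 1%g).
have lL : left_invariant_vf L by exact: left_field_invariant.
apply/eqP; rewrite -subr_eq0 -(ip_eq0 (ip a)) (ipBl (ip a)) subr_eq0; apply/eqP.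
move: (X a - L a) => v; have := FX a v; rewrite /randers gT => /addrI ->.
by rewrite -[X 1%g](left_field1 (G := N)) -/L (XT L a lL) gT.
Qed.

Lemma randers_dataP X : lie_algebra N X -> randers_data g X <->
  0 < Num.sqrt (g 1%g (X 1%g) (X 1%g)) < 1.
Proof.
move=> [sX lX]; have gX p : g p (X p) (X p) = g 1%g (X 1%g) (X 1%g).
  exact: vf_inner_left_invariant.
rewrite sqrtr_gt0 lt0r (ip_eq0 (ip _)) (ip_ge0 (ip _)) andbT; split.
  move=> [_ X0 X1]; rewrite X1 andbT; apply: contra_not_neq X0 => X10.
  by rewrite (left_invariant_fieldE lX) X10 left_field0.
move=> /andP[X0 X1]; split=> // [XE|p]; last by rewrite gX.
by rewrite XE eqxx in X0.
Qed.

(** Left invariance makes the fields on [N] vectors, and parallel means central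
    and orthogonal to all brackets: this reduces the geometry to linear algebra. *)
Lemma berwald_randersP X : two_step_nilpotent N ->
  left_invariant_berwald_randers g X <->
  [/\ 0 < Num.sqrt (g 1%g (X 1%g) (X 1%g)) < 1, lie_center N X &
      forall Y Z, lie_algebra N Y -> lie_algebra N Z ->
        g 1%g (X 1%g) (lie_bracket Y Z 1%g) = 0].
Proof.
move=> nil; split=> [[rX /left_invariant_finslerP lX pX]|[X1 cX oX]].
  have lieX : lie_algebra N X by split=> //; case: rX.
  split; [exact/randers_dataP| |].
    by split=> // Y lY; exact: parallel_central.
  by move=> Y Z lY lZ; exact: parallel_orthogonal.
have [[sX lX] _] := cX; split; first exact/randers_dataP.
  exact/left_invariant_finslerP.
exact: central_orthogonal_parallel.
Qed.

End LieAlgebra.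

(** * Berwald type Randers metrics in dimension five *)

Theorem mainTheorem4 (R : realType) (N : lieGroupType R 5)
    (g : N -> 'rV[R]_5 -> 'rV[R]_5 -> R)
    (N_simply_connected : simply_connected N)
    (N_two_step : two_step_nilpotent N)
    (g_riemannian : riemannian g)
    (g_left_invariant : left_invariant_metric g) :
  ((exists X, left_invariant_berwald_randers g X) <->
     has_dim (lie_center N) 3) /\
  (forall (e1 e2 e3 e4 e5 : N -> 'rV[R]_5) (lambda : R),
     let e := [tuple e1; e2; e3; e4; e5] in
     is_basis (lie_algebra N) e ->
     (forall (i j : 'I_5) (p : N),
        vf_inner g (tnth e i) (tnth e j) p = (i == j)%:R) ->
     0 < lambda ->
     lie_bracket e1 e2 = lambda *: e3 ->
     (forall i j : 'I_5, (i < j)%N ->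
        (nat_of_ord i, nat_of_ord j) != (0, 1)%N ->
        lie_bracket (tnth e i) (tnth e j) = 0) ->
     is_basis (lie_center N) [tuple e3; e4; e5] ->
     (forall q1 q2 : R, 0 < Num.sqrt (q1 ^+ 2 + q2 ^+ 2) < 1 ->
        left_invariant_berwald_randers g (q1 *: e4 + q2 *: e5)) /\
     (forall Q, lie_algebra N Q -> parallel g Q ->
        exists q1 q2 : R,
          Q = q1 *: e4 + q2 *: e5 /\
          (randers_data g Q -> 0 < Num.sqrt (q1 ^+ 2 + q2 ^+ 2) < 1))).
Proof.
have ip p := riemannian_ip p g_riemannian.
have [nonab nil] := two_step_unit_bracket N_two_step.
have linB := @unit_bracket_linear R 5 N.
have altB := @unit_bracketC R 5 N.
have berwaldP X := berwald_randersP g_riemannian g_left_invariant X N_two_step.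
split.
  have [Z ZE] := center_mx_exists linB altB.
  rewrite (has_dim_lie_center ZE);
  split=> [[X /berwaldP[X1 cX oX]]|rZ].
    have [_ XZ] := (lie_centerP ZE X).1 cX.
    apply: (center_orthogonal_dim linB altB nil nonab (ip 1%g) ZE (x := X 1%g)) => //.
      by apply: contraTneq X1 => ->; rewrite (ip0l (ip _)) sqrtr0 ltxx.
    by move=> u v; apply: oX; exact: lie_algebra_left_field.
  have [x [x0 xZ xB]] :=
    center_orthogonal_exists linB altB (ip 1%g) ZE rZ.
  have [_ _ /(_ x x0) gx] := ip 1%g.
  (* This factor makes the length 1/2. *)
  pose s := (2 * Num.sqrt (g 1%g x x))^-1.
  have s0 : 0 < s by rewrite invr_gt0 mulr_gt0// sqrtr_gt0.
  exists (left_field (s *: x)).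
  apply/berwaldP.
  rewrite left_field1; split.
  - rewrite (ipZl (ip _)) (ipZr (ip _)) mulrA -expr2 sqrtrM ?sqr_ge0//.
    rewrite sqrtr_sqr gtr0_norm// /s invfM -mulrA mulVf ?gt_eqF ?sqrtr_gt0// mulr1.
    by rewrite invr_gt0 ltr0n invf_lt1 ?ltr1n.
  - by apply/(lie_center_left_field ZE); exact: scalemx_sub.
  - move=> Y W /lie_algebraP -> /lie_algebraP ->.
    by rewrite (ipZl (ip _)) xB mulr0.
move=> e1 e2 e3 e4 e5 lambda e be oe lambda0 e12 e0 bz.
have le i : lie_algebra N (tnth e i) by exact: is_basis_mem be.
have cz i : lie_center N (tnth [tuple e3; e4; e5] i) by exact: is_basis_mem bz.
have c4 : lie_center N e4 := cz (Ordinal (isT : (1 < 3)%N)).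
have c5 : lie_center N e5 := cz (Ordinal (isT : (2 < 3)%N)).
have l1 : lie_algebra N e1 := le (Ordinal (isT : (0 < 5)%N)).
have l2 : lie_algebra N e2 := le (Ordinal (isT : (1 < 5)%N)).
have l4 : lie_algebra N e4 by case: c4.
have l5 : lie_algebra N e5 by case: c5.
pose o i j (hi : (i < 5)%N) (hj : (j < 5)%N) p := oe (Ordinal hi) (Ordinal hj) p.
have g33 p : g p (e3 p) (e3 p) = 1 := o 2 2 isT isT p.
have g43 p : g p (e4 p) (e3 p) = 0 := o 3 2 isT isT p.
have g44 p : g p (e4 p) (e4 p) = 1 := o 3 3 isT isT p.
have g45 p : g p (e4 p) (e5 p) = 0 := o 3 4 isT isT p.
have g53 p : g p (e5 p) (e3 p) = 0 := o 4 2 isT isT p.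
have g54 p : g p (e5 p) (e4 p) = 0 := o 4 3 isT isT p.
have g55 p : g p (e5 p) (e5 p) = 1 := o 4 4 isT isT p.
have normQ q1 q2 p :
    g p ((q1 *: e4 + q2 *: e5) p) ((q1 *: e4 + q2 *: e5) p) = q1 ^+ 2 + q2 ^+ 2.
  rewrite -[(_ + _) p]/(q1 *: e4 p + q2 *: e5 p).
  rewrite !(ipDl (ip p)) !(ipZl (ip p)) !(ipDr (ip p)) !(ipZr (ip p)) g44 g45 g54 g55.
  by ring.
have QE q1 q2 : q1 *: e4 + q2 *: e5 =
    \sum_(i < 2) (if i == 0 then q1 else q2) *: (if i == 0 then e4 else e5).
  by rewrite big_ord_recl big_ord1.
split=> [q1 q2 q12|Q lQ pQ].
  apply/berwaldP.
  split; first by rewrite normQ.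
    by rewrite QE; apply: lie_center_sum => i; case: ifP.
  set Q := q1 *: e4 + q2 *: e5.
  have Q3 : g 1%g (Q 1%g) (e3 1%g) = 0.
    rewrite -[Q 1%g]/(q1 *: e4 1%g + q2 *: e5 1%g).
    by rewrite (ipDl (ip _)) !(ipZl (ip _)) g43 g53 !mulr0 addr0.
  have Qlt (i j : 'I_5) : (i < j)%N ->
      g 1%g (Q 1%g) (lie_bracket (tnth e i) (tnth e j) 1%g) = 0.
    move=> ij; have [[i0 j1]|ij01] := eqVneq (nat_of_ord i, nat_of_ord j) (0, 1)%N.
      have -> : i = Ordinal (isT : (0 < 5)%N) by exact: val_inj.
      have -> : j = Ordinal (isT : (1 < 5)%N) by exact: val_inj.
      rewrite -[lie_bracket _ _]/(lie_bracket e1 e2) e12.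
      by rewrite -[(_ *: _) _]/(lambda *: e3 1%g) (ipZr (ip _)) Q3 mulr0.
    by rewrite e0// (ip0r (ip _)).
  have Qbr (i j : 'I_5) : g 1%g (Q 1%g) (lie_bracket (tnth e i) (tnth e j) 1%g) = 0.
    have [ij|ji|ij] := ltngtP i j; first exact: Qlt.
      by rewrite lie_bracketC (ipC (ip _)) (ipNl (ip _)) (ipC (ip _)) Qlt// oppr0.
    have <- : i = j by exact: val_inj.
    by rewrite /lie_bracket subrr (ip0r (ip _)).
  have sm i : smooth_vf (tnth e i) by case: (le i).
  have [_ lieE] := be; rewrite lieE => Y W [y ->] [w ->].
  rewrite (lie_bracket_suml _ _ _ sm) fct_sumE (ip_sumr (ip _)) big1// => i _.
  rewrite (lie_bracket_sumr _ _ _ sm).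
  rewrite -[(_ *: _) _]/(y i *:
    (\sum_j w j *: lie_bracket (tnth e i) (tnth e j)) 1%g).
  rewrite fct_sumE (ipZr (ip _)) (ip_sumr (ip _)) big1 ?mulr0// => j _.
  rewrite -[(_ *: _) _]/(w j *: lie_bracket (tnth e i) (tnth e j) 1%g).
  by rewrite (ipZr (ip _)) Qbr mulr0.
have : lie_center N Q.
  by split=> // Y lY; exact: (parallel_central g_riemannian g_left_invariant).
have [_ ->] := bz => -[c]; rewrite !big_ord_recl big_ord0 addr0.
rewrite -[tnth _ ord0]/e3 -[tnth _ (lift ord0 ord0)]/e4 -[tnth _ (lift ord0 _)]/e5.
set c3 := c ord0; set q1 := c (lift ord0 ord0).
set q2 := c (lift ord0 (lift ord0 ord0)) => QE'.
(* Q is orthogonal to the bracket of e1 and e2, a nonzero multiple of e3. *)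
have c30 : c3 = 0.
  have := parallel_orthogonal g_riemannian g_left_invariant 1%g lQ pQ l1 l2.
  rewrite e12 -[(_ *: _) _]/(lambda *: e3 1%g) QE'.
  rewrite -[(_ + _) _]/(c3 *: e3 1%g + (q1 *: e4 1%g + q2 *: e5 1%g)).
  rewrite (ipZr (ip _)) !(ipDl (ip _)) !(ipZl (ip _)) g33 g43 g53 !mulr0 !addr0 mulr1.
  by move/eqP; rewrite mulf_eq0 gt_eqF//= => /eqP.
exists q1, q2; split; first by rewrite QE' c30 scale0r add0r.
move=> /(randers_dataP g_riemannian g_left_invariant lQ).
by rewrite QE' c30 scale0r add0r normQ.
Qed.
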